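(* Let $d\ge 1$. Let $\varrho$ be a probability density on $\mathbb R^d$ with $\varrho(x)=\varrho(-x)$ and $\int x_ix_j\varrho(x)\,dx=\sigma_\varrho^2\delta_{ij}$ for $1\le i,j\le d$, where $\sigma_\varrho>0$. Assume that $\varrho$ is bounded above by a constant and that there is $\delta>0$ such that $\int|x|^{\max\{2,d-2+\delta\}}\varrho(x)dx<\infty$. Let $r_n\in(0,1]$ be a sequence with $r_n\downarrow0$. Then there is a constant ($C_1$ if $d=1$, $C_2$ if $d=2$, $C_d$ if $d\ge3$), depending only on $d$ and $\varrho$, such that for every $R>0$, with $D=B(0,R)$, $$g^{n,D}(z)\le g_R(z)\qquad\text{for all }z\in\mathbb R^d\text{ and }n\in\mathbb N,$$ where $$g_R(z):=\begin{cases}C_1R\,\mathbf 1_{B(0,R)}(z)&\text{if }d=1,\\ C_2\big((\log(R/|z|))^++1\big)\mathbf 1_{B(0,R)}(z)&\text{if }d=2,\\ C_d|z|^{2-d}\mathbf 1_{B(0,R)}(z)&\text{if }d\ge3.\end{cases}$$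
   Context: $B(0,R)$ is the open Euclidean ball. Put $\varrho_r(x)=r^{-d}\varrho(x/r)$. For an open set $D\subset\mathbb R^d$, $q^{n,D}_k(x,y)$ ($k\ge1$) is the $k$-step transition density of the discrete-time random walk with step density $\varrho_{r_n}$ killed upon leaving $D$. That is, $q^{n,D}_1(x,y)=\varrho_{r_n}(y-x)\mathbf 1_D(x)\mathbf 1_D(y)$ and $q^{n,D}_{k+1}(x,y)=\int q^{n,D}_k(x,z)q^{n,D}_1(z,y)dz$. Define $$g^{n,D}(x,y):=\sigma_\varrho^2r_n^2\sum_{k=2}^\infty q^{n,D}_k(x,y),\qquad g^{n,D}(z):=g^{n,D}(0,z).$$ This is the occupation density, from the second jump until leaving $D$, of the continuous-time random walk with step density $\varrho_{r_n}$ and jump rate $(\sigma_\varrho^2r_n^2)^{-1}$. *)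

(* Defs.v *)
From HB Require Import structures.
From mathcomp Require Import all_boot all_order all_algebra.
From mathcomp Require Import all_classical all_reals all_analysis.
Set Implicit Arguments.
Unset Strict Implicit.
Unset Printing Implicit Defensive.
Import Order.TTheory GRing.Theory Num.Theory.
Import numFieldNormedType.Exports.

Local Open Scope classical_set_scope.
Local Open Scope ring_scope.

(* Row vectors 'rV[R]_n carry the sigma-algebra generated by the n coordinate
   maps, that is, the Borel sigma-algebra of R^n. *)
Definition rV_display : measure_display -> measure_display.
Proof. exact. Qed.

Section measurable_rV.
Context {R : realType} (n : nat).

Let coord_rV : 'I_n -> 'rV[R]_n -> measurableTypeR R := fun i x => x ord0 i.

Let rV_set0 : g_sigma_preimage coord_rV set0.
Proof. exact: sigma_algebra0. Qed.

Let rV_setC A : g_sigma_preimage coord_rV A -> g_sigma_preimage coord_rV (~` A).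
Proof. exact: sigma_algebraC. Qed.

Let rV_bigcup (F : (set 'rV[R]_n)^nat) :
  (forall i, g_sigma_preimage coord_rV (F i)) ->
  g_sigma_preimage coord_rV (\bigcup_i (F i)).
Proof. exact: sigma_algebra_bigcup. Qed.

HB.instance Definition _ := @isMeasurable.Build
  (rV_display default_measure_display) 'rV[R]_n
  (g_sigma_preimage coord_rV) rV_set0 rV_setC rV_bigcup.

Lemma measurable_coord_rV (i : 'I_n) :
  measurable_fun [set: 'rV[R]_n] (fun x => x ord0 i : measurableTypeR R).
Proof.
move=> _ Y mY; rewrite setTI; apply: sub_sigma_algebra => /=.
rewrite -bigcup_seq/=; exists i => /=; first by rewrite mem_index_enum.
by exists Y => //; rewrite setTI.
Qed.

Lemma measurable_fun_rVP d (T : measurableType d) (f : T -> 'rV[R]_n) :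
  (forall i, measurable_fun [set: T] (fun x => f x ord0 i : measurableTypeR R)) ->
  measurable_fun [set: T] f.
Proof.
move=> mf _ A mA; rewrite setTI.
suff : g_sigma_preimage coord_rV `<=` [set B | measurable (f @^-1` B)] by apply.
apply: smallest_sub.
  split => /=.
  - by rewrite preimage_set0.
  - by move=> B mB /=; rewrite setTD preimage_setC; exact: measurableC.
  - by move=> F mF /=; rewrite preimage_bigcup; exact: bigcupT_measurable.
rewrite -bigcup_seq; apply: bigcup_sub => i _ _ [B mB <-] /=.
by rewrite setTI; have := mf i measurableT B mB; rewrite setTI.
Qed.

End measurable_rV.

Section lebesgue_rV.
Context {R : realType}.

Definition cons_rV n (p : measurableTypeR R * 'rV[R]_n) : 'rV[R]_n.+1 :=
  \row_i if unlift ord0 i is Some j then p.2 ord0 j else p.1.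

Definition behead_rV n (x : 'rV[R]_n.+1) : 'rV[R]_n :=
  \row_i x ord0 (lift ord0 i).

Lemma cons_rVK n (p : measurableTypeR R * 'rV[R]_n) :
  ((cons_rV p) ord0 ord0, behead_rV (cons_rV p)) = p.
Proof.
case: p => x v; congr pair; first by rewrite mxE unlift_none.
by apply/rowP => i; rewrite !mxE liftK.
Qed.

Lemma measurable_cons_rV n : measurable_fun setT (@cons_rV n).
Proof.
apply: measurable_fun_rVP => i; rewrite /cons_rV.
have [j ->|->] := unliftP ord0 i.
  under eq_fun do rewrite mxE liftK.
  exact: measurableT_comp (measurable_coord_rV j) measurable_snd.
under eq_fun do rewrite mxE unlift_none.
exact: measurable_fst.
Qed.

Lemma measurable_behead_rV n : measurable_fun setT (@behead_rV n).
Proof.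
apply: measurable_fun_rVP => i; under eq_fun do rewrite mxE.
exact: measurable_coord_rV.
Qed.

Section step.
Context n (m : {sigma_finite_measure set 'rV[R]_n -> \bar R}).

Definition lebesgue_rV_step : set 'rV[R]_n.+1 -> \bar R :=
  pushforward (@lebesgue_measure R \x m)%E (@cons_rV n).

Let step0 : (lebesgue_rV_step set0 = 0)%E.
Proof. by rewrite /lebesgue_rV_step /pushforward preimage_set0 measure0. Qed.

Let step_ge0 A : (0 <= lebesgue_rV_step A)%E.
Proof. by rewrite /lebesgue_rV_step /pushforward measure_ge0. Qed.

Let step_sigma_additive : semi_sigma_additive lebesgue_rV_step.
Proof.
move=> F mF tF mUF; rewrite /lebesgue_rV_step /pushforward preimage_bigcup.
have mc A : measurable A -> measurable (@cons_rV n @^-1` A).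
  by move=> mA; rewrite -[X in measurable X]setTI; exact: measurable_cons_rV.
apply: measure_semi_sigma_additive.
- by move=> k; exact: mc.
- apply/trivIsetP => /= i j _ _ ij; rewrite -preimage_setI.
  by move/trivIsetP : tF => /(_ _ _ _ _ ij) ->//; rewrite preimage_set0.
- by rewrite -preimage_bigcup; exact: mc.
Qed.

HB.instance Definition _ := isMeasure.Build _ _ _
  lebesgue_rV_step step0 step_ge0 step_sigma_additive.

Let step_sigma_finite : sigma_finite setT lebesgue_rV_step.
Proof.
have /sigma_finiteP[F [TF ndF Foo]] := sigma_finiteT (@lebesgue_measure R).
have /sigma_finiteP[G [TG ndG Goo]] := sigma_finiteT m.
pose h (x : 'rV[R]_n.+1) : measurableTypeR R * 'rV[R]_n :=
  (x ord0 ord0, behead_rV x).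
have mh : measurable_fun setT h.
  by apply: measurable_fun_pair;
    [exact: measurable_coord_rV|exact: measurable_behead_rV].
exists (fun k => h @^-1` (F k `*` G k)).
  apply/seteqP; split => // x _.
  have [i _ Fi] : (\bigcup_i F i) (h x).1 by rewrite -TF.
  have [j _ Gj] : (\bigcup_i G i) (h x).2 by rewrite -TG.
  exists (maxn i j) => //; split.
    by move: Fi; exact/subsetPset/ndF/leq_maxl.
  by move: Gj; exact/subsetPset/ndG/leq_maxr.
move=> k; have [mF Foo'] := Foo k; have [mG Goo'] := Goo k; split.
  by rewrite -[X in measurable X]setTI; apply: mh => //; exact: measurableX.
rewrite /lebesgue_rV_step /pushforward -comp_preimage.
rewrite (_ : h \o _ = id) ?preimage_id; last first.
  by apply/funext => p; exact: cons_rVK.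
by rewrite product_measure1E// lte_mul_pinfty// ge0_fin_numE.
Qed.

HB.instance Definition _ := Measure_isSigmaFinite.Build _ _ _
  lebesgue_rV_step step_sigma_finite.

End step.

(* Lebesgue measure on R^n: the n-fold product of the one-dimensional one. *)
Fixpoint lebesgue_rV n : {sigma_finite_measure set 'rV[R]_n -> \bar R} :=
  match n with
  | 0%N => dirac (0 : 'rV[R]_0)
  | n'.+1 => lebesgue_rV_step (lebesgue_rV n')
  end.

Lemma lebesgue_rV_box n (A : 'I_n -> set (measurableTypeR R)) :
  (forall i, measurable (A i)) ->
  lebesgue_rV n [set x : 'rV[R]_n | forall i, A i (x ord0 i)] =
  (\prod_(i < n) lebesgue_measure (A i))%E.
Proof.
elim: n A => [|n IH] A mA.
  by rewrite big_ord0 /= diracE mem_set// => -[].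
rewrite big_ord_recl -IH//= /lebesgue_rV_step /pushforward.
rewrite -product_measure1E//; last first.
  rewrite (_ : mkset _ = \bigcap_i (if insub i is Some j then
      (fun x : 'rV[R]_n => x ord0 j : measurableTypeR R) @^-1` A (lift ord0 j)
      else setT)).
    apply: bigcap_measurable => // k _; case: insubP => [j _ _|_]//.
    by rewrite -[X in measurable X]setTI; exact: measurable_coord_rV.
  apply/seteqP; split => x /=.
    by move=> Ax k _; case: insubP => //= j _ _; exact: Ax.
  by move=> Ax i; have := Ax i I; rewrite valK.
congr product_measure1; apply/seteqP; split => -[x v] /=.
  move=> Axv; split; first by have := Axv ord0; rewrite mxE unlift_none.
  by move=> i; have := Axv (lift ord0 i); rewrite mxE liftK.
move=> [Ax Av] i; rewrite mxE.
by have [j ->|->] := unliftP ord0 i; [exact: Av|exact: Ax].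
Qed.

End lebesgue_rV.
Arguments lebesgue_rV : clear implicits.

Section random_walk.
Context {R : realType} {d : nat}.
Implicit Types (x y z : 'rV[R]_d) (D : set 'rV[R]_d) (p rho : 'rV[R]_d -> R).

(* The norm `|x| of the library is the sup norm. *)
Definition enorm x : R := Num.sqrt (\sum_(i < d) x ord0 i ^+ 2).

Definition eball (a : R) : set 'rV[R]_d := [set x | enorm x < a].

Definition scaled_density rho (r : R) : 'rV[R]_d -> R :=
  fun x => r ^- d * rho (r^-1 *: x).

Local Open Scope ereal_scope.

Definition killed_step p D x y : \bar R :=
  (p (y - x)%R * \1_D x * \1_D y)%:E.

(* k-step transition density for k >= 1; the index k = 0 is not meaningful. *)
Definition killed_density p D (k : nat) : 'rV[R]_d -> 'rV[R]_d -> \bar R :=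
  iter k.-1
    (fun q x y => \int[lebesgue_rV R d]_z (q x z * killed_step p D z y))
    (killed_step p D).

Definition killed_green rho (sigma r : R) D x y : \bar R :=
  (sigma ^+ 2 * r ^+ 2)%:E *
  \sum_(2 <= k <oo) killed_density (scaled_density rho r) D k x y.

(* In dimensions d >= 2 both log (a / |z|) and |z|^(2 - d) (d >= 3) are read
   as +oo at z = 0. *)
Definition green_bound (C a : R) z : \bar R :=
  match d with
  | 1%N => (C * a)%:E
  | 2%N => if z == 0%R then +oo
           else (C * (Num.max (ln (a / enorm z)) 0 + 1))%:E
  | _ => if z == 0%R then +oo else (C * enorm z ^ (2 - d%:Z))%:E
  end * (\1_(eball a) z)%:E.

End random_walk.

(* Main.v *)
(** The walk has symmetric kernel, so phi = p_{2k} is the autocorrelation of p_k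
    and u_k = phi(0) is its maximum. Since rho is in L^2, p_2 >= c on a box Q
    around 0, whence u_k - u_{k+1} >= c * int_Q (u_k - phi); as the gap
    D = u_k - phi satisfies D(2v) <= 4 D(v), averages of D over dyadic dilates of
    Q are controlled, and int phi = 1 turns this into a discrete Nash inequality
    giving sup p_k <= A k^(-d/2). A Taylor estimate for symmetric steps gives
    E|S_k|^m <= B k^(m/2) with m = max(2, d - 2 + delta); splitting p_k = p_i * p_j
    with i, j about k/2 then gives |z|^m p_k(z) <= C k^((m-d)/2). Summing the two
    bounds below and above k = |z|^2 settles d >= 3. For d <= 2, the decay of p_T
    shows that the walk leaves B(0,a) with probability at least 1/2 within
    T ~ a^2 steps, so the terms k > T contribute at most twice those of one period.
    General r follows from r = 1 by scaling. *)
From HB Require Import structures.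
Require Import Defs.
From mathcomp Require Import all_boot all_order all_algebra.
From mathcomp Require Import all_classical all_reals all_analysis measurable_realfun.
From mathcomp Require Import zify ring lra.
Import Order.TTheory GRing.Theory Num.Theory.
Import numFieldNormedType.Exports.
Set Implicit Arguments.
Unset Strict Implicit.
Unset Printing Implicit Defensive.

Local Open Scope classical_set_scope.
Local Open Scope ring_scope.

(** * Lebesgue measure on row vectors *)

Section lebesgue_rV_facts.
Context {R : realType}.
Local Open Scope ereal_scope.

(** The lower bound [c] for [p 2] is available only on a box of fixed size, whereas after [k] steps
    the mass has spread to distances of order the square root of [k]. The quadratic growth of the
    gap carries information from the small box out to scale [2 ^+ j] at a relative cost [4 ^+ j];
    with [4 ^+ j] comparable to [k] this is exactly the cost that a decay of order [k^(-d/2)]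
    tolerates.

    The moment exponent [m] is dictated by the terms up to [k = |z|^2]: the sum of [k^((m - d)/2)]
    is there of order [|z|^(m - d + 2)] provided [(m - d)/2 > -1], that is [m > d - 2]; the
    requirement [m >= 2] comes from the second-order Taylor estimate. Starting the series at [k = 2]
    matters: nothing pointwise is known about [rho] beyond boundedness, and both the off-diagonal
    bound and, in dimension 1, the smallness in [a] use two factors.

    Since the constants must not depend on [r], the unit-scale bounds are proved for all radii
    [a / r], including radii far below the length of one step. *)

Lemma ge0_integral_affine_real (f : measurableTypeR R -> \bar R) (s b : R) : s != 0%R ->
  measurable_fun setT f -> (forall t, 0 <= f t) ->
  \int[@lebesgue_measure R]_t f (s * t + b)%R =
  (`|s|^-1)%:E * \int[@lebesgue_measure R]_t f t.
Proof.
move=> s0 mf f0.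
have mphi : measurable_fun setT
    (fun t : measurableTypeR R => (s * t + b)%R : measurableTypeR R).
  by apply: measurable_funD => //; exact: mulrl_measurable.
pose phi : {mfun measurableTypeR R >-> measurableTypeR R} :=
  HB.pack (fun t : measurableTypeR R => (s * t + b)%R)
    (isMeasurableFun.Build _ _ _ _ _ mphi).
have abs_gt0 : (0 < `|s|)%R by rewrite normr_gt0.
have k0 : (0 <= `|s|)%R by exact: ltW.
(* Uniqueness of Lebesgue measure reduces the change of variables to the intervals []u, v]]; a
   negative [s] turns the preimage into an interval closed on the left and open on the right. *)
have E A : measurable A ->
    @lebesgue_measure R A =
    mscale (NngNum k0) (pushforward (@lebesgue_measure R) phi) A.
  apply: lebesgue_measure_unique => _ [[u v]] _ <-.
  change (@lebesgue_measure R `]u, v] = `|s|%:E *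
    @lebesgue_measure R ((fun t : R => s * t + b)%R @^-1` `]u, v])).
  have [sp|sn] := ltP 0%R s.
    rewrite [X in _ * lebesgue_measure X](_ : _ = `]((u - b) / s)%R, ((v - b) / s)%R]%classic).
      rewrite !lebesgue_measure_itv/= !lte_fin ltr_pM2r ?invr_gt0// ltrD2r.
      case: ifPn => _; last by rewrite mule0.
      by rewrite -EFinD -EFinM -mulrBl gtr0_norm// mulrC divfK// opprB addrA subrK.
    apply/seteqP; split => t /=; rewrite !in_itv/= ltr_pdivrMr// ler_pdivlMr//;
      by rewrite ltrBlDr lerBrDr (mulrC t).
  have {}sn : (s < 0)%R by rewrite lt_neqAle s0.
  rewrite [X in _ * lebesgue_measure X](_ : _ = `[((v - b) / s)%R, ((u - b) / s)%R[%classic).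
    rewrite !lebesgue_measure_itv/= !lte_fin ltr_nM2r ?invr_lt0// ltrD2r.
    case: ifPn => _; last by rewrite mule0.
    rewrite -EFinD -EFinM -mulrBl ltr0_norm// mulrC mulrN divfK//.
    by congr _%:E; ring.
  by apply/seteqP; split => t /=;
    rewrite !in_itv/= ltr_ndivlMr// ler_ndivrMr// ltrBlDr lerBrDr (mulrC t) andbC.
rewrite [in RHS](@eq_measure_integral _ _ _ _
  (mscale (NngNum k0) (pushforward (@lebesgue_measure R) phi))).
  rewrite ge0_integral_mscale// ge0_integral_pushforward//=.
  by rewrite muleA -EFinM mulVf ?mul1e// gt_eqF.
by move=> A mA _; exact: E.
Qed.

Lemma ge0_integral_rVS n (f : 'rV[R]_n.+1 -> \bar R) :
  measurable_fun setT f -> (forall x, 0 <= f x) ->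
  \int[lebesgue_rV R n.+1]_x f x =
  \int[@lebesgue_measure R]_t \int[lebesgue_rV R n]_v f (cons_rV (t, v)).
Proof.
move=> mf f0.
rewrite [LHS](ge0_integral_pushforward (@measurable_cons_rV R n)
  (@lebesgue_measure R \x lebesgue_rV R n)%E measurableT mf) ?preimage_setT//.
  rewrite (fubini_tonelli1 (f \o @cons_rV R n))//; last first.
    by move=> x; exact: f0.
  exact: measurableT_comp mf (@measurable_cons_rV R n).
Qed.

Lemma measurable_rVD d (T : measurableType d) n (f g : T -> 'rV[R]_n) :
  measurable_fun setT f -> measurable_fun setT g ->
  measurable_fun setT (fun x => f x + g x)%R.
Proof.
move=> mf mg; apply: measurable_fun_rVP => i.
under eq_fun do rewrite mxE.
apply: measurable_funD.
  exact: measurableT_comp (measurable_coord_rV i) mf.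
exact: measurableT_comp (measurable_coord_rV i) mg.
Qed.

Lemma measurable_rVZ d (T : measurableType d) n (f : T -> 'rV[R]_n) (s : R) :
  measurable_fun setT f -> measurable_fun setT (fun x => s *: f x)%R.
Proof.
move=> mf; apply: measurable_fun_rVP => i.
under eq_fun do rewrite mxE.
apply: measurable_funM => //.
exact: measurableT_comp (measurable_coord_rV i) mf.
Qed.

Lemma measurable_rVN d (T : measurableType d) n (f : T -> 'rV[R]_n) :
  measurable_fun setT f -> measurable_fun setT (fun x => - f x)%R.
Proof.
by move=> mf; under eq_fun do rewrite -scaleN1r; exact: measurable_rVZ.
Qed.

Lemma measurable_rVB d (T : measurableType d) n (f g : T -> 'rV[R]_n) :
  measurable_fun setT f -> measurable_fun setT g ->
  measurable_fun setT (fun x => f x - g x)%R.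
Proof. by move=> mf mg; apply: measurable_rVD => //; exact: measurable_rVN. Qed.

(** Peeling off the first coordinate, the induction collects one factor [|s|^-1] from each
    one-dimensional integral. *)
Lemma ge0_integral_affine n (f : 'rV[R]_n -> \bar R) (s : R) (b : 'rV[R]_n) :
  s != 0%R -> measurable_fun setT f -> (forall x, 0 <= f x) ->
  \int[lebesgue_rV R n]_x f (s *: x + b)%R =
  (`|s| ^- n)%:E * \int[lebesgue_rV R n]_x f x.
Proof.
move=> s0; elim: n f b => [|n IH] f b mf f0.
  rewrite expr0 invr1 mul1e; apply: eq_integral => x _.
  by rewrite (thinmx0 (s *: x + b)%R) (thinmx0 x).
have mconsf t : measurable_fun setT (fun v => f (cons_rV (t, v))).
  apply: measurableT_comp => //.
  apply: (measurableT_comp (@measurable_cons_rV R n)).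
  exact: measurable_fun_pair.
have mF : measurable_fun [set: measurableTypeR R] (fun t => \int[lebesgue_rV R n]_v f (cons_rV (t, v))).
  apply: (measurable_fun_fubini_tonelli_F (f \o @cons_rV R n)) => //=.
  exact: measurableT_comp mf (@measurable_cons_rV R n).
rewrite !ge0_integral_rVS//; last first.
  apply: measurableT_comp => //; apply: measurable_rVD => //.
  exact: measurable_rVZ.
transitivity (\int[@lebesgue_measure R]_t ((`|s| ^- n)%:E *
    \int[lebesgue_rV R n]_v f (cons_rV ((s * t + b ord0 ord0)%R, v)))).
  apply: eq_integral => t _; rewrite -(IH _ (behead_rV b))//.
  apply: eq_integral => v _; congr f.
  apply/rowP => i; rewrite /cons_rV !mxE; have [j ->|->] := unliftP ord0 i.
    by rewrite /= !mxE.
  by [].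
have mst : measurable_fun [set: measurableTypeR R]
    (fun t => (s * t + b ord0 ord0)%R : measurableTypeR R).
  by apply: measurable_funD => //; exact: mulrl_measurable.
rewrite ge0_integralZl//=.
- rewrite (ge0_integral_affine_real (b ord0 ord0) s0 mF); last first.
    by move=> t; exact: integral_ge0.
  by rewrite muleA -EFinM -invfM -exprSr.
- exact: measurableT_comp mF mst.
- by move=> ? _; exact: integral_ge0.
Qed.

End lebesgue_rV_facts.

(** * Transition densities *)

Section killed_kernel.
Context {R : realType} {d : nat}.
Local Open Scope ereal_scope.
Implicit Types (f g : 'rV[R]_d -> \bar R) (x y z w : 'rV[R]_d) (K L N : 'rV[R]_d -> 'rV[R]_d -> \bar R).

Lemma tonelli_rV K :
  measurable_fun setT (fun p : 'rV[R]_d * 'rV[R]_d => K p.1 p.2) ->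
  (forall x y, 0 <= K x y) ->
  \int[lebesgue_rV R d]_x \int[lebesgue_rV R d]_y K x y =
  \int[lebesgue_rV R d]_y \int[lebesgue_rV R d]_x K x y.
Proof. by move=> mK K0; exact: (fubini_tonelli (fun p => K p.1 p.2)). Qed.

Lemma ge0_integral_comp_sub f (b : 'rV[R]_d) :
  measurable_fun setT f -> (forall x, 0 <= f x) ->
  \int[lebesgue_rV R d]_x f (x - b)%R = \int[lebesgue_rV R d]_x f x.
Proof.
move=> mf f0; have := ge0_integral_affine (- b) (oner_neq0 R) mf f0.
rewrite normr1 expr1n invr1 mul1e => <-.
by apply: eq_integral => x _; rewrite scale1r.
Qed.

Lemma ge0_integral_comp_rsub f (b : 'rV[R]_d) :
  measurable_fun setT f -> (forall x, 0 <= f x) ->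
  \int[lebesgue_rV R d]_x f (b - x)%R = \int[lebesgue_rV R d]_x f x.
Proof.
move=> mf f0; have N10 : (-1 : R)%R != 0%R by rewrite oppr_eq0 oner_neq0.
have := ge0_integral_affine b N10 mf f0.
rewrite normrN1 expr1n invr1 mul1e => <-.
by apply: eq_integral => x _; rewrite scaleN1r addrC.
Qed.

Variables (rho : 'rV[R]_d -> R) (D : set 'rV[R]_d).
Hypothesis mrho : measurable_fun setT rho.
Hypothesis rho0 : forall x, (0 <= rho x)%R.
Hypothesis mD : measurable D.

Let kd := killed_density rho D.

Lemma killed_step_ge0 x y : 0 <= killed_step rho D x y.
Proof. by rewrite lee_fin !mulr_ge0. Qed.

Lemma measurable_killed_step :
  measurable_fun setT (fun p : 'rV[R]_d * 'rV[R]_d => killed_step rho D p.1 p.2).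
Proof.
have mI (h : 'rV[R]_d * 'rV[R]_d -> 'rV[R]_d) : measurable_fun setT h ->
    measurable_fun setT (fun p => \1_D (h p) : R).
  by move=> mh; apply: (measurableT_comp (f := \1_D : 'rV[R]_d -> R)).
apply/measurable_EFinP; apply: measurable_funM; last exact: mI measurable_snd.
apply: measurable_funM; last exact: mI measurable_fst.
apply: measurableT_comp => //; apply: measurable_rVB.
  exact: measurable_snd.
exact: measurable_fst.
Qed.

Lemma killed_densityS k x y : kd k.+2 x y =
  \int[lebesgue_rV R d]_z (kd k.+1 x z * killed_step rho D z y).
Proof. by []. Qed.

Lemma killed_density_ge0 k x y : 0 <= kd k x y.
Proof.
(* Because of the [k.-1] in [killed_density], indices 0 and 1 give the same kernel; this accounts
   for the extra case here and before the inductions below. *)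
case: k => [|k]; first exact: killed_step_ge0.
elim: k x y => [|k IH] x y; first exact: killed_step_ge0.
rewrite killed_densityS; apply: integral_ge0 => z _.
by rewrite mule_ge0//; exact: killed_step_ge0.
Qed.

Lemma measurable_kernel_comp K L :
  measurable_fun setT (fun p : 'rV[R]_d * 'rV[R]_d => K p.1 p.2) ->
  measurable_fun setT (fun p : 'rV[R]_d * 'rV[R]_d => L p.1 p.2) ->
  (forall x y, 0 <= K x y) -> (forall x y, 0 <= L x y) ->
  measurable_fun setT (fun p : 'rV[R]_d * 'rV[R]_d =>
    \int[lebesgue_rV R d]_z (K p.1 z * L z p.2)).
Proof.
move=> mK mL K0 L0.
apply: (measurable_fun_fubini_tonelli_F
  (fun q : ('rV[R]_d * 'rV[R]_d) * 'rV[R]_d => K q.1.1 q.2 * L q.2 q.1.2)).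
  apply: emeasurable_funM.
    have m : measurable_fun setT
        (fun q : ('rV[R]_d * 'rV[R]_d) * 'rV[R]_d => (q.1.1, q.2)).
      apply: measurable_fun_pair => //.
      exact: measurableT_comp measurable_fst measurable_fst.
    exact: measurableT_comp mK m.
  have m : measurable_fun setT
      (fun q : ('rV[R]_d * 'rV[R]_d) * 'rV[R]_d => (q.2, q.1.2)).
    apply: measurable_fun_pair => //.
    exact: measurableT_comp measurable_snd measurable_fst.
  exact: measurableT_comp mL m.
by move=> q; rewrite mule_ge0.
Qed.

Lemma measurable_killed_density k :
  measurable_fun setT (fun p : 'rV[R]_d * 'rV[R]_d => kd k p.1 p.2).
Proof.
case: k => [|k]; first exact: measurable_killed_step.
elim: k => [|k IH]; first exact: measurable_killed_step.
apply: (measurable_kernel_comp (K := kd k.+1) (L := killed_step rho D)) => //.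
- exact: measurable_killed_step.
- by move=> x y; exact: killed_density_ge0.
- by move=> x y; exact: killed_step_ge0.
Qed.

Lemma measurable_killed_densityl k y : measurable_fun setT (fun x => kd k x y).
Proof.
apply: (measurableT_comp (measurable_killed_density k) (g := fun x => (x, y))).
exact: measurable_fun_pair.
Qed.

Lemma measurable_killed_densityr k x : measurable_fun setT (kd k x).
Proof.
apply: (measurableT_comp (measurable_killed_density k) (g := fun y => (x, y))).
exact: measurable_fun_pair.
Qed.

Lemma kernel_compA K L N x y :
  measurable_fun setT (K x) ->
  measurable_fun setT (fun p : 'rV[R]_d * 'rV[R]_d => L p.1 p.2) ->
  measurable_fun setT (fun z => N z y) ->
  (forall x y, 0 <= K x y) -> (forall x y, 0 <= L x y) ->
  (forall x y, 0 <= N x y) ->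
  \int[lebesgue_rV R d]_w ((\int[lebesgue_rV R d]_z (K x z * L z w)) * N w y) =
  \int[lebesgue_rV R d]_z (K x z * \int[lebesgue_rV R d]_w (L z w * N w y)).
Proof.
move=> mK mL mN K0 L0 N0.
have mLl w : measurable_fun setT (fun z => L z w).
  apply: (measurableT_comp mL (g := fun z => (z, w))).
  exact: measurable_fun_pair.
have mLr z : measurable_fun setT (fun w => L z w).
  apply: (measurableT_comp mL (g := fun w => (z, w))).
  exact: measurable_fun_pair.
transitivity (\int[lebesgue_rV R d]_w \int[lebesgue_rV R d]_z (K x z * L z w * N w y)).
  apply: eq_integral => w _; rewrite -ge0_integralZr//.
    by apply: emeasurable_funM.
  by move=> z _; rewrite mule_ge0.
rewrite tonelli_rV//.
- apply: eq_integral => z _; rewrite -ge0_integralZl//.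
  + by apply: eq_integral => w _; rewrite muleA.
  + exact: emeasurable_funM.
  + by move=> w _; rewrite mule_ge0.
- apply: emeasurable_funM; last exact: measurableT_comp mN measurable_fst.
  apply: emeasurable_funM; first exact: measurableT_comp mK measurable_snd.
  apply: (measurableT_comp mL (g := fun q => (q.2, q.1))).
  exact: measurable_fun_pair.
- by move=> w z; rewrite !mule_ge0.
Qed.

(** Chapman-Kolmogorov. [killed_density] appends its steps on the right, so the induction is on [j],
    and associativity of kernel composition moves the new step inside. *)
Lemma killed_density_add i j x y : kd (i.+1 + j.+1) x y =
  \int[lebesgue_rV R d]_z (kd i.+1 x z * kd j.+1 z y).
Proof.
elim: j x y => [|j IH] x y; first by rewrite addn1 killed_densityS.
rewrite addnS addSn killed_densityS.
under eq_integral do rewrite -addSn IH.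
rewrite kernel_compA//.
- exact: measurable_killed_densityr.
- exact: measurable_killed_density.
- exact: measurable_killed_densityl 1%N y.
- exact: killed_density_ge0.
- exact: killed_density_ge0.
- exact: killed_step_ge0.
Qed.

End killed_kernel.

(** * The free walk: comparison with the killed walk, mass, translation invariance and symmetry *)

Section free_walk.
Context {R : realType} {d : nat}.
Local Open Scope ereal_scope.
Implicit Types (D : set 'rV[R]_d) (x y z w b : 'rV[R]_d).

Variable rho : 'rV[R]_d -> R.
Hypothesis mrho : measurable_fun setT rho.
Hypothesis rho0 : forall x, (0 <= rho x)%R.
Hypothesis rho1 : \int[lebesgue_rV R d]_x (rho x)%:E = 1.
Hypothesis rhoN : forall x, rho x = rho (- x).
Variable M : R.
Hypothesis rhoM : forall x, (rho x <= M)%R.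

Let mrhoE : measurable_fun setT (fun x => (rho x)%:E).
Proof. exact/measurable_EFinP. Qed.

Lemma killed_step_mono D D' x y : D `<=` D' ->
  killed_step rho D x y <= killed_step rho D' x y.
Proof.
move=> DD'; have ind z : (\1_D z <= \1_D' z :> R)%R.
  rewrite !indicE ler_nat; case: (boolP (z \in D)) => //= zD.
  by rewrite mem_set//; apply: DD'; rewrite -inE.
by rewrite lee_fin !ler_pM ?mulr_ge0.
Qed.

(** With [D' := setT] this compares the killed walk with the free one, which is how bounds on
    [walk_density] reach the killed densities. *)
Lemma killed_density_mono D D' k x y : measurable D -> measurable D' ->
  D `<=` D' -> killed_density rho D k x y <= killed_density rho D' k x y.
Proof.
move=> mD mD' DD'; case: k => [|k]; first exact: killed_step_mono.
elim: k x y => [|k IH] x y; first exact: killed_step_mono.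
rewrite !killed_densityS; apply: ge0_le_integral => //.
- by move=> z _; rewrite mule_ge0 ?killed_density_ge0 ?killed_step_ge0.
- apply: emeasurable_funM; first exact: measurable_killed_densityr.
  exact: (measurable_killed_densityl mrho rho0 mD 1%N y).
- apply: emeasurable_funM; first exact: measurable_killed_densityr.
  exact: (measurable_killed_densityl mrho rho0 mD' 1%N y).
- by move=> z _; apply: lee_pmul => //;
    [exact: killed_density_ge0|exact: killed_step_ge0|exact: killed_step_mono].
Qed.

Lemma killed_stepT x y : killed_step rho setT x y = (rho (y - x))%:E.
Proof. by rewrite /killed_step !indicT !mulr1. Qed.

Lemma killed_stepT_mass x : \int[lebesgue_rV R d]_y killed_step rho setT x y = 1.
Proof.
under eq_integral do rewrite killed_stepT.
by rewrite (ge0_integral_comp_sub (f := fun y => (rho y)%:E)).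
Qed.

Lemma killed_densityT_mass k x :
  \int[lebesgue_rV R d]_y killed_density rho setT k x y = 1.
Proof.
case: k => [|k]; first exact: killed_stepT_mass.
elim: k x => [|k IH] x; first exact: killed_stepT_mass.
under eq_integral do rewrite killed_densityS.
have mk := measurable_killed_density mrho rho0 measurableT.
have mkr := measurable_killed_densityr mrho rho0 measurableT.
rewrite tonelli_rV.
- rewrite -(IH x); apply: eq_integral => z _.
  rewrite ge0_integralZl//.
  + by rewrite killed_stepT_mass mule1.
  + exact: mkr 1%N z.
  + by move=> y _; exact: killed_step_ge0.
  + exact: killed_density_ge0.
- apply: emeasurable_funM.
    apply: (measurableT_comp (mkr k.+1 x) (g := snd)).
    exact: measurable_snd.
  apply: (measurableT_comp (mk 1%N) (g := fun p => (p.2, p.1))).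
  exact: measurable_fun_pair.
- by move=> y z; rewrite mule_ge0 ?killed_density_ge0 ?killed_step_ge0.
Qed.

Lemma killed_density_mass_le1 D k x : measurable D ->
  \int[lebesgue_rV R d]_y killed_density rho D k x y <= 1.
Proof.
move=> mD; rewrite -(killed_densityT_mass k x); apply: ge0_le_integral => //.
- by move=> y _; exact: killed_density_ge0.
- exact: measurable_killed_densityr.
- exact: measurable_killed_densityr.
- by move=> y _; exact: killed_density_mono.
Qed.

Lemma killed_step_le D x y : killed_step rho D x y <= M%:E.
Proof.
rewrite (le_trans (killed_step_mono _ _ (@subsetT _ D)))//.
by rewrite killed_stepT lee_fin.
Qed.

(** The last step has density at most [M] and is averaged against a kernel of total mass at most 1.
    Finiteness of all densities follows from this. *)
Lemma killed_density_le D k x y : measurable D ->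
  killed_density rho D k x y <= M%:E.
Proof.
move=> mD; case: k => [|[|k]]; [exact: killed_step_le|exact: killed_step_le|].
have M0 : (0 <= M)%R by exact: le_trans (rho0 0) (rhoM 0).
have mkr := measurable_killed_densityr mrho rho0 mD.
rewrite killed_densityS.
apply: (@le_trans _ _ (\int[lebesgue_rV R d]_z
    (killed_density rho D k.+1 x z * M%:E))).
  apply: ge0_le_integral => //.
  - by move=> z _; rewrite mule_ge0 ?killed_density_ge0 ?killed_step_ge0.
  - apply: emeasurable_funM => //.
    exact: (measurable_killed_densityl mrho rho0 mD 1%N y).
  - exact: emeasurable_funM.
  - move=> z _; rewrite lee_wpmul2l ?killed_density_ge0//.
    exact: killed_step_le.
rewrite ge0_integralZr//; last by move=> z _; exact: killed_density_ge0.
rewrite -[leRHS]mul1e lee_wpmul2r// ?lee_fin//.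
exact: killed_density_mass_le1.
Qed.

Lemma killed_density_fin D k x y : measurable D ->
  killed_density rho D k x y \is a fin_num.
Proof.
move=> mD; rewrite ge0_fin_numE ?killed_density_ge0//.
by rewrite (le_lt_trans (killed_density_le _ _ _ mD))// ltry.
Qed.

Lemma killed_densityT_shift k x y b :
  killed_density rho setT k (x + b) (y + b) = killed_density rho setT k x y.
Proof.
have step_shift u v : killed_step rho setT (u + b) (v + b) =
    killed_step rho setT u v.
  by rewrite !killed_stepT opprD addrACA subrr addr0.
case: k => [|k]; first exact: step_shift.
elim: k x y => [|k IH] x y; first exact: step_shift.
rewrite !killed_densityS.
rewrite -[LHS](ge0_integral_comp_sub (- b)).
- by apply: eq_integral => z _; rewrite opprK IH step_shift.
- apply: emeasurable_funM; first exact: measurable_killed_densityr.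
  exact: (measurable_killed_densityl mrho rho0 measurableT 1%N).
- by move=> z; rewrite mule_ge0 ?killed_density_ge0 ?killed_step_ge0.
Qed.

Lemma killed_densityT_opp k x y :
  killed_density rho setT k (- x) (- y) = killed_density rho setT k x y.
Proof.
have step_opp u v : killed_step rho setT (- u) (- v) =
    killed_step rho setT u v.
  by rewrite !killed_stepT -opprD -rhoN.
case: k => [|k]; first exact: step_opp.
elim: k x y => [|k IH] x y; first exact: step_opp.
rewrite !killed_densityS.
rewrite -[LHS](ge0_integral_comp_rsub 0).
- by apply: eq_integral => z _; rewrite sub0r IH step_opp.
- apply: emeasurable_funM; first exact: measurable_killed_densityr.
  exact: (measurable_killed_densityl mrho rho0 measurableT 1%N).
- by move=> z; rewrite mule_ge0 ?killed_density_ge0 ?killed_step_ge0.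
Qed.

(** The free kernel depends on [y - x] only, and this is its profile: the [k]-fold convolution power
    of [rho] for [k >= 1], and [rho] again at [k = 0]. [fine] loses nothing because the density is
    bounded by [M]. *)
Definition walk_density k z : R := fine (killed_density rho setT k 0 z).

Lemma killed_densityTE k x y :
  killed_density rho setT k x y = (walk_density k (y - x))%:E.
Proof.
rewrite /walk_density fineK; last exact: killed_density_fin.
by rewrite -(killed_densityT_shift k 0 (y - x) x) add0r subrK.
Qed.

Lemma killed_density_le_walk D k x y : measurable D ->
  killed_density rho D k x y <= (walk_density k (y - x))%:E.
Proof. by move=> mD; rewrite -killed_densityTE; exact: killed_density_mono. Qed.

Lemma walk_density_ge0 k z : (0 <= walk_density k z)%R.
Proof. by rewrite fine_ge0// killed_density_ge0. Qed.

Lemma walk_density_le k z : (walk_density k z <= M)%R.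
Proof.
by rewrite -lee_fin -[z in walk_density _ z]subr0 -killed_densityTE killed_density_le.
Qed.

Lemma walk_densityN k z : walk_density k (- z) = walk_density k z.
Proof. by rewrite /walk_density -[in LHS]oppr0 killed_densityT_opp. Qed.

Lemma walk_density1 z : walk_density 1 z = rho z.
Proof. by rewrite /walk_density /killed_density/= !indicT !mulr1 subr0. Qed.

Lemma measurable_walk_density k : measurable_fun setT (walk_density k).
Proof.
apply/measurable_EFinP.
rewrite (_ : EFin \o _ = killed_density rho setT k 0); last first.
  by apply/funext => z /=; rewrite killed_densityTE subr0.
exact: measurable_killed_densityr.
Qed.

Lemma walk_density_mass k : \int[lebesgue_rV R d]_z (walk_density k z)%:E = 1.
Proof.
rewrite -(killed_densityT_mass k 0); apply: eq_integral => z _.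
by rewrite killed_densityTE subr0.
Qed.

Lemma walk_density_add i j z : (walk_density (i.+1 + j.+1) z)%:E =
  \int[lebesgue_rV R d]_y (walk_density i.+1 y * walk_density j.+1 (z - y))%:E.
Proof.
rewrite -[in LHS](subr0 z) -killed_densityTE killed_density_add//.
by apply: eq_integral => y _; rewrite !killed_densityTE subr0 -EFinM.
Qed.

End free_walk.

(** * Lower bound for the two-step density *)

Section shift_continuity.
Context {R : realType} {d : nat}.
Local Open Scope ereal_scope.
Implicit Types (A B : set 'rV[R]_d) (x h : 'rV[R]_d) (L e : R).

(** Cubes are preferred to Euclidean balls because their volume is explicit and dilations permute
    them. *)
Definition box (L : R) : set 'rV[R]_d := [set x | forall i, (`|x ord0 i| <= L)%R].

Lemma measurable_rV_box (A : 'I_d -> set (measurableTypeR R)) :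
  (forall i, measurable (A i)) ->
  measurable [set x : 'rV[R]_d | forall i, A i (x ord0 i)].
Proof.
move=> mA; rewrite (_ : mkset _ = \bigcap_(i in setT)
    ((fun x : 'rV[R]_d => x ord0 i : measurableTypeR R) @^-1` A i)).
  apply: fin_bigcap_measurable => // i _.
  by rewrite -[X in measurable X]setTI; exact: measurable_coord_rV.
by apply/seteqP; split => x /= Ax i; [move=> _|]; exact: Ax.
Qed.

Lemma boxE L : box L = [set x : 'rV[R]_d | forall i,
  (`[(- L)%R, L]%classic : set (measurableTypeR R)) (x ord0 i)].
Proof.
by apply/seteqP; split => x /= xL i; have := xL i; rewrite /= in_itv/= ler_norml.
Qed.

Lemma measurable_box L : measurable (box L).
Proof.
rewrite boxE; apply: (measurable_rV_box (A := fun=> `[(- L)%R, L]%classic)).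
by move=> i; exact: measurable_itv.
Qed.

Lemma lebesgue_box L : (0 <= L)%R ->
  lebesgue_rV R d (box L) = ((2 * L) ^+ d)%:E.
Proof.
move=> L0; rewrite boxE (lebesgue_rV_box (A := fun=> `[(- L)%R, L]%classic))//.
rewrite (eq_bigr (fun=> (2 * L)%:E)).
  by rewrite prodEFin prodr_const card_ord.
move=> i _; rewrite lebesgue_measure_itv/= lte_fin.
case: ifPn => [_|]; first by rewrite -EFinD; congr _%:E; ring.
by rewrite -leNgt => LL; congr _%:E; lra.
Qed.

Lemma measurable_shift A h : measurable A -> measurable [set x | A (x + h)%R].
Proof.
move=> mA; rewrite (_ : mkset _ = (fun x => x + h)%R @^-1` A)//.
rewrite -[X in measurable X]setTI.
by apply: measurable_rVD => //; exact: measurable_id.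
Qed.

Lemma lebesgue_shift A h : measurable A ->
  lebesgue_rV R d [set x | A (x + h)%R] = lebesgue_rV R d A.
Proof.
move=> mA; have mAh := measurable_shift h mA.
have E B : measurable B ->
    lebesgue_rV R d B = \int[lebesgue_rV R d]_x (\1_B x)%:E.
  by move=> mB; rewrite integral_indic// setIT.
rewrite !E// -(ge0_integral_comp_sub (- h)%R (f := fun x => (\1_A x)%:E)).
- apply: eq_integral => x _; rewrite opprK !indicE.
  by rewrite (_ : (x \in mkset _) = (x + h \in A)%R)//; apply/idP/idP; rewrite !inE.
- by apply/measurable_EFinP; exact: measurable_indic.
- by move=> x; rewrite lee_fin.
Qed.

(** One half of a symmetric difference; the other half is the same set for the complement of [A].
    The cube keeps all measures finite. *)
Definition shift_diff L A h := box L `&` (A `\` [set x | A (x - h)%R]).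

(* Being closed under complements and countable unions, this property holds for
   all measurable sets as soon as it holds for half-spaces. *)
Definition shift_continuous A := measurable A /\
  forall L e, (0 < L)%R -> (0 < e)%R -> exists2 delta : R, (0 < delta)%R &
    forall h, box delta h -> lebesgue_rV R d (shift_diff L A h) <= e%:E.

Lemma measurable_shift_diff L A h : measurable A -> measurable (shift_diff L A h).
Proof.
move=> mA; apply: measurableI; first exact: measurable_box.
by apply: measurableD => //; exact: measurable_shift.
Qed.

Lemma shift_continuous0 : shift_continuous set0.
Proof.
split=> // L e L0 e0; exists 1%R => // h _.
by rewrite /shift_diff set0D setI0 measure0 lee_fin ltW.
Qed.

(** After a translation, the difference set of the complement lies in the one of [A] for the
    opposite shift. The translation may leave the cube, hence [L + 1] and shifts bounded by 1. *)
Lemma shift_continuousC A : shift_continuous A -> shift_continuous (~` A).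
Proof.
move=> [mA cA]; split; first exact: measurableC.
move=> L e L0 e0; have L10 : (0 < L + 1)%R by rewrite addr_gt0.
have [del del0 cdel] := cA _ _ L10 e0.
exists (Num.min del 1)%R; first by rewrite lt_min del0 ltr01.
move=> h hd; have mS := measurable_shift_diff L h (measurableC mA).
rewrite -(lebesgue_shift h)//; apply: le_trans (cdel (- h)%R _); last first.
  by move=> i; rewrite mxE normrN; have := hd i; rewrite le_min => /andP[].
apply: le_measure.
- by rewrite inE; exact: measurable_shift.
- by rewrite inE; exact: measurable_shift_diff.
move=> x /= [xL [nAx Axh]]; split => [i|]; last first.
  split; last by rewrite /= opprK.
  by move: Axh; rewrite /= addrK; apply: contrapT.
have := xL i; have := hd i; rewrite !mxE le_min => /andP[_ h1] xhL.
rewrite -(addrK (h ord0 i) (x ord0 i)) (le_trans (ler_normB _ _))//.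
exact: lerD.
Qed.

Lemma shift_continuousU A B :
  shift_continuous A -> shift_continuous B -> shift_continuous (A `|` B).
Proof.
move=> [mA cA] [mB cB]; split; first exact: measurableU.
move=> L e L0 e0; have e20 : (0 < e / 2)%R by rewrite divr_gt0.
have [d1 d10 c1] := cA _ _ L0 e20; have [d2 d20 c2] := cB _ _ L0 e20.
exists (Num.min d1 d2); first by rewrite lt_min d10.
move=> h hd.
have h1 : box d1 h by move=> i; have := hd i; rewrite le_min => /andP[].
have h2 : box d2 h by move=> i; have := hd i; rewrite le_min => /andP[].
apply: (@le_trans _ _ (lebesgue_rV R d (shift_diff L A h `|` shift_diff L B h))).
  apply: le_measure; rewrite ?inE.
  - by apply: measurable_shift_diff; exact: measurableU.
  - by apply: measurableU; exact: measurable_shift_diff.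
  by move=> x [xL [[Ax|Bx] /= /not_orP[nA nB]]]; [left|right].
have := measureU2 (lebesgue_rV R d) (measurable_shift_diff L h mA)
  (measurable_shift_diff L h mB).
move=> /le_trans; apply; rewrite [e in leRHS]splitr EFinD.
by apply: leeD; [exact: c1|exact: c2].
Qed.

Lemma shift_continuous_bigcup (F : (set 'rV[R]_d)^nat) :
  (forall k, shift_continuous (F k)) -> shift_continuous (\bigcup_k F k).
Proof.
move=> cF; have mF : measurable (\bigcup_k F k).
  by apply: bigcupT_measurable => k; exact: (cF k).1.
split=> // L e L0 e0; have e20 : (0 < e / 2)%R by rewrite divr_gt0.
pose G n := \big[setU/set0]_(k < n) F k.
have cG n : shift_continuous (G n).
  elim: n => [|n IH]; first by rewrite /G big_ord0; exact: shift_continuous0.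
  by rewrite /G big_ord_recr; exact: shift_continuousU.
pose H n := box L `&` (\bigcup_k F k `\` G n).
have mH n : measurable (H n).
  apply: measurableI; first exact: measurable_box.
  by apply: measurableD => //; exact: (cG n).1.
have capH : \bigcap_n H n = set0.
  rewrite -subset0 => x Hx; have [_ [[k _ Fkx] _]] := Hx 0%N I.
  have [_ [_]] := Hx k.+1 I; apply.
  by rewrite /G big_ord_recr; right.
(* The sets [H n] decrease to the empty set inside a cube of finite measure, so some finite union
   [G N] misses less than [e / 2] of the whole union within the cube. *)
have [N HN] : exists N, lebesgue_rV R d (H N) < (e / 2)%:E.
  apply: contrapT => /forallNP nH.
  have HC : (lebesgue_rV R d \o H) n @[n --> \oo] --> lebesgue_rV R d (\bigcap_n H n).
    apply: nonincreasing_cvg_mu => //.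
    - apply: (@le_lt_trans _ _ (lebesgue_rV R d (box L))).
        apply: le_measure; rewrite ?inE//; first exact: measurable_box.
        by move=> x [].
      by rewrite lebesgue_box ?ltW// ltry.
    - by rewrite capH.
    - move=> n m nm; apply/subsetPset; apply: setIS; apply: setDS.
      exact: subset_bigsetU.
  rewrite capH measure0 in HC.
  have : (e / 2)%:E <= limn (lebesgue_rV R d \o H).
    apply: lime_ge; first by apply/cvg_ex; exists 0.
    by apply: nearW => n; rewrite leNgt; apply/negP; exact: nH.
  by rewrite (cvg_lim _ HC)// lee_fin leNgt e20.
have [del del0 cdel] := (cG N).2 _ _ L0 e20.
exists del => // h hd.
have mGN := (cG N).1.
apply: (@le_trans _ _ (lebesgue_rV R d (shift_diff L (G N) h `|` H N))).
  apply: le_measure; rewrite ?inE.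
  - exact: measurable_shift_diff.
  - by apply: measurableU => //; exact: measurable_shift_diff.
  move=> x [xL [Fx nFx]]; have [Gx|nGx] := pselect (G N x); last by right.
  left; split => //; split => //= Gxh; apply: nFx => /=.
  move: Gxh; rewrite /G -bigcup_mkord => -[k _ Fk]; by exists k.
have := measureU2 (lebesgue_rV R d) (measurable_shift_diff L h mGN) (mH N).
move=> /le_trans; apply; rewrite [e in leRHS]splitr EFinD.
by apply: leeD; [exact: cdel|exact: ltW].
Qed.

(** Inside the cube the difference lies in a slab of thickness [del] in direction [i], whose volume
    is at most [del * K]. *)
Lemma shift_continuous_halfspace (i : 'I_d) (t : R) :
  shift_continuous [set x | (t < x ord0 i)%R].
Proof.
have mH : measurable [set x : 'rV[R]_d | (t < x ord0 i)%R].
  have := @measurable_coord_rV R d i measurableT `]t, +oo[%classic.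
  rewrite setTI => /(_ (measurable_itv _)).
  by congr measurable; apply/seteqP; split => x /=; rewrite in_itv/= andbT.
split=> // L e L0 e0.
pose K := (\prod_(j < d | j != i) (2 * L))%R.
have K0 : (0 <= K)%R by apply: prodr_ge0 => j _; rewrite mulr_ge0// ltW.
exists (e / (K + 1))%R; first by rewrite divr_gt0// ltr_wpDl.
move=> h hd; set del := (e / (K + 1))%R.
have del0 : (0 < del)%R by rewrite divr_gt0// ltr_wpDl.
pose B (j : 'I_d) : set (measurableTypeR R) :=
  if j == i then `]t, (t + del)%R]%classic else `[(- L)%R, L]%classic.
have mB j : measurable (B j) by rewrite /B; case: ifP.
apply: (@le_trans _ _ (lebesgue_rV R d [set x | forall j, B j (x ord0 j)])).
  apply: le_measure; rewrite ?inE.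
  - exact: measurable_shift_diff.
  - exact: measurable_rV_box.
  move=> x [xL [/= tx /negP]]; rewrite -leNgt !mxE => xt j.
  rewrite /B; case: eqP => [->|_] /=; rewrite in_itv/=.
    rewrite tx/= -lerBlDl; rewrite lerBlDl -lerBlDr (le_trans _ xt)// lerD2l lerN2.
    exact: le_trans (ler_norm _) (hd i).
  by rewrite -ler_norml.
rewrite lebesgue_rV_box// (bigD1 i)//= (eq_bigr (fun=> (2 * L)%:E)); last first.
  move=> j /negbTE ji; rewrite /B ji lebesgue_measure_itv/= lte_fin.
  case: ifPn => [_|]; first by rewrite -EFinD; congr _%:E; ring.
  by rewrite -leNgt => LL; congr _%:E; lra.
rewrite /B eqxx lebesgue_measure_itv/= lte_fin ltrDl del0 prodEFin -EFinD -EFinM.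
rewrite lee_fin addrAC subrr add0r -/K /del mulrAC ler_pdivrMr ?ltr_wpDl//.
by rewrite ler_pM2l// lerDl.
Qed.

Lemma measurable_shift_continuous A : measurable A -> shift_continuous A.
Proof.
have sC : sigma_algebra setT shift_continuous.
  split; first exact: shift_continuous0.
  - by move=> B cB; rewrite setTD; exact: shift_continuousC.
  - exact: shift_continuous_bigcup.
apply: smallest_sub => //.
rewrite -bigcup_seq; apply: bigcup_sub => i _ _ [B mB <-] /=; rewrite setTI.
pose c := (fun x : 'rV[R]_d => x ord0 i).
suff: (@ocitv R).-sigma.-measurable `<=`
    [set B : set R | shift_continuous (c @^-1` B)] by apply.
rewrite RGenOInfty.measurableE; apply: smallest_sub.
  split => /=.
  - by rewrite preimage_set0; exact: shift_continuous0.
  - by move=> C cC; rewrite setTD preimage_setC; exact: shift_continuousC.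
  - by move=> F cF; rewrite preimage_bigcup; exact: shift_continuous_bigcup.
move=> _ [t ->] /=; have := shift_continuous_halfspace i t.
by congr shift_continuous; apply/seteqP; split => x /=; rewrite in_itv/= andbT.
Qed.

End shift_continuity.

(** * Positivity of the two-step density near the origin *)

Section two_step_lower_bound.
Context {R : realType} {d : nat}.
Local Open Scope ereal_scope.

Variable rho : 'rV[R]_d -> R.
Hypothesis mrho : measurable_fun setT rho.
Hypothesis rho0 : forall x, (0 <= rho x)%R.
Hypothesis rho1 : \int[lebesgue_rV R d]_x (rho x)%:E = 1.
Hypothesis rhoN : forall x, rho x = rho (- x).
Variable M : R.
Hypothesis rhoM : forall x, (rho x <= M)%R.

Let S (n : nat) : set 'rV[R]_d := [set x | (n.+1%:R^-1 < rho x)%R].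

Let mS n : measurable (S n).
Proof.
have := mrho measurableT (measurable_itv `]n.+1%:R^-1%R, +oo[).
by rewrite setTI; congr measurable; apply/seteqP; split => x /=; rewrite in_itv/= andbT.
Qed.

(** These sets exhaust [{rho > 0}]; were they all null, [rho] would integrate to 0. *)
Lemma density_superlevel_pos : exists n : nat,
  0 < lebesgue_rV R d (box n%:R `&` [set x | (n.+1%:R^-1 < rho x)%R]).
Proof.
apply: contrapT => /forallNP nS.
have Sn0 n : lebesgue_rV R d (box n%:R `&` S n) = 0.
  have /negP := nS n; rewrite -leNgt => le0.
  by apply/eqP; rewrite eq_le le0/=.
have mBS n : measurable (box n%:R `&` S n).
  by apply: measurableI => //; exact: measurable_box.
have mU : measurable (\bigcup_n (box n%:R `&` S n)) by exact: bigcupT_measurable.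
have U0 : lebesgue_rV R d (\bigcup_n (box n%:R `&` S n)) = 0.
  apply/negligibleP => //; apply: negligible_bigcup => n.
  by apply/negligibleP; [exact: mBS|exact: Sn0].
have : \int[lebesgue_rV R d]_x (rho x)%:E = 0.
  rewrite -(null_set_integral (f := EFin \o rho) mU _ U0); last first.
    by apply: measurable_funTS; exact/measurable_EFinP.
  rewrite [RHS]integral_mkcond; apply: eq_integral => x _.
  rewrite patchE; case: ifPn => //= /negP xU; congr _%:E.
  apply/eqP; rewrite eq_le rho0 andbT leNgt; apply/negP => rx0; apply: xU.
  (* [t] dominates every coordinate of [x] and the inverse of [rho x], so one integer above [t]
     places [x] both in the box and in the superlevel set. *)
  rewrite inE; pose t := (\sum_i `|x ord0 i| + (rho x)^-1)%R.
  have t0 : (0 <= t)%R by rewrite addr_ge0 ?invr_ge0// sumr_ge0.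
  exists (Num.bound t) => //; have bt := archi_boundP t0.
  split => [i|]; rewrite /S /=.
    rewrite (le_trans _ (ltW bt))// /t (bigD1 i)//= -addrA lerDl.
    by rewrite addr_ge0 ?invr_ge0// sumr_ge0.
  rewrite -[ltRHS]invrK ltf_pV2 ?posrE ?invr_gt0//.
  apply: (@lt_trans _ _ (Num.bound t)%:R); last by rewrite ltr_nat.
  by rewrite (le_lt_trans _ bt)// /t lerDr sumr_ge0.
by rewrite rho1 => /eqP; rewrite onee_eq0.
Qed.

(** A Steinhaus argument. [rho] exceeds [eta] on a bounded set of measure [m > 0]; for small [v] the
    part of it lying also in [A + v] keeps measure at least [m / 2], and there both factors of the
    convolution exceed [eta], the second one by evenness of [rho]. *)
Lemma walk_density2_lower_bound : exists c eps : R,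
  [/\ (0 < c)%R, (0 < eps)%R &
    forall v : 'rV[R]_d, box eps v -> (c <= walk_density rho 2 v)%R].
Proof.
have [n n0] := density_superlevel_pos.
pose eta : R := n.+1%:R^-1%R; have eta0 : (0 < eta)%R by rewrite invr_gt0.
pose A := S n.
have mBA : measurable (box n%:R `&` A).
  exact: measurableI (measurable_box _) (mS n).
have finBA : lebesgue_rV R d (box n%:R `&` A) \is a fin_num.
  rewrite ge0_fin_numE//; apply: (@le_lt_trans _ _ (lebesgue_rV R d (box n%:R))).
    by apply: le_measure; rewrite ?inE//; exact: measurable_box.
  by rewrite lebesgue_box ?ler0n// ltry.
pose m := fine (lebesgue_rV R d (box n%:R `&` A)).
have m0 : (0 < m)%R by rewrite fine_gt0// n0 ltey_eq finBA.
have [_ cA] := measurable_shift_continuous (mS n).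
(* [n] may be 0, while shift continuity asks for a cube of positive size. *)
have L0 : (0 < n%:R + 1 :> R)%R by rewrite ltr_wpDl.
have [eps eps0 ceps] := cA _ _ L0 (divr_gt0 m0 (ltr0n _ 2)).
exists (eta ^+ 2 * (m / 2))%R, eps; split => //.
  by rewrite mulr_gt0 ?exprn_gt0 ?divr_gt0.
move=> v vd; pose E := box n%:R `&` A `&` [set x | A (x - v)%R].
have mE : measurable E.
  exact: measurableI mBA (measurable_shift (- v) (mS n)).
have Em : (m / 2)%:E <= lebesgue_rV R d E.
  have : m%:E <= (m / 2)%:E + lebesgue_rV R d E.
    rewrite /m fineK//; apply: (@le_trans _ _ (lebesgue_rV R d
        (shift_diff (n%:R + 1) A v `|` E))).
      apply: le_measure; rewrite ?inE//.
        exact: measurableU (measurable_shift_diff _ _ (mS n)) mE.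
      move=> x [xL Ax]; have [Axv|nAxv] := pselect (A (x - v)%R); first by right.
      left; split => [i|//]; by rewrite (le_trans (xL i))// lerDl.
    have mSD := measurable_shift_diff (n%:R + 1) v (mS n).
    have := measureU2 (lebesgue_rV R d) mSD mE.
    move=> /le_trans; apply; rewrite leeD2r//.
    exact: ceps.
  by rewrite -leeBlDl// -EFinB {1}[m]splitr addrK.
have := walk_density_add mrho rho0 rho1 rhoM 0 0 v; rewrite addn1 => w2.
rewrite -lee_fin w2; apply: (@le_trans _ _ (\int[lebesgue_rV R d]_y
    ((eta ^+ 2)%:E * (\1_E y)%:E))).
  rewrite ge0_integralZl ?lee_fin ?sqr_ge0//; last first.
    by apply/measurable_EFinP; exact: measurable_indic.
  by rewrite integral_indic// setIT EFinM lee_wpmul2l// lee_fin sqr_ge0.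
apply: ge0_le_integral => //.
- by move=> y _; rewrite -EFinM lee_fin mulr_ge0// sqr_ge0.
- apply: emeasurable_funM => //.
  by apply/measurable_EFinP; exact: measurable_indic.
- apply/measurable_EFinP; apply: measurable_funM.
    exact: measurable_walk_density.
  apply: measurableT_comp; first exact: (measurable_walk_density mrho rho0 rho1 rhoM).
  by apply: measurable_rVB => //; exact: measurable_id.
- move=> y _; rewrite -EFinM lee_fin !walk_density1 indicE.
  case: (boolP (y \in E)) => [|_]; last by rewrite mulr0 mulr_ge0.
  rewrite inE => -[[_ Ay] Ayv]; rewrite mulr1 expr2 ler_pM ?ltW//.
  by rewrite rhoN opprB.
Qed.

End two_step_lower_bound.

(** * Decay on the diagonal *)

Section autocorrelation.
Context {R : realType} {d : nat}.
Local Open Scope ereal_scope.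

Variable rho : 'rV[R]_d -> R.
Hypothesis mrho : measurable_fun setT rho.
Hypothesis rho0 : forall x, (0 <= rho x)%R.
Hypothesis rho1 : \int[lebesgue_rV R d]_x (rho x)%:E = 1.
Hypothesis rhoN : forall x, rho x = rho (- x).
Variable M : R.
Hypothesis rhoM : forall x, (rho x <= M)%R.

Local Notation p := (walk_density rho).
Implicit Types v b y : 'rV[R]_d.

Let p0 k z : (0 <= p k z)%R. Proof. exact: walk_density_ge0. Qed.
Let mp k : measurable_fun setT (p k).
Proof. exact: (measurable_walk_density mrho rho0 rho1 rhoM). Qed.
Let pN k z : p k (- z) = p k z. Proof. exact: walk_densityN. Qed.

Let mpsub k (v : 'rV[R]_d) : measurable_fun setT (fun y => p k (y - v)%R).
Proof.
by apply: measurableT_comp => //; apply: measurable_rVB => //; exact: measurable_id.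
Qed.

Lemma walk_density_double k v : (p k.+1.*2 v)%:E =
  \int[lebesgue_rV R d]_y (p k.+1 y * p k.+1 (y - v))%:E.
Proof.
rewrite -addnn (walk_density_add mrho rho0 rho1 rhoM).
by apply: eq_integral => y _; rewrite -opprB pN.
Qed.

(** The free base point [b] allows several correlations to be written under one integral as the
    cross terms of a single square. *)
Lemma walk_density_double_shift k v b : (p k.+1.*2 v)%:E =
  \int[lebesgue_rV R d]_y (p k.+1 (y - b) * p k.+1 (y - (b + v)))%:E.
Proof.
rewrite walk_density_double -[LHS](ge0_integral_comp_sub b)//.
- by apply: eq_integral => y _; rewrite opprD addrA.
- by apply/measurable_EFinP; exact: measurable_funM.
- by move=> y; rewrite lee_fin mulr_ge0.
Qed.

(** Cauchy-Schwarz, in the form of the integral of [(p k.+1 y - p k.+1 (y - v)) ^+ 2 >= 0]. *)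
Lemma walk_density_double_le k v : (p k.+1.*2 v <= p k.+1.*2 0)%R.
Proof.
suff : 2%:E * (p k.+1.*2 v)%:E <= (p k.+1.*2 0)%:E + (p k.+1.*2 0)%:E.
  by rewrite -EFinM -EFinD lee_fin => ?; lra.
rewrite {1}(walk_density_double_shift k 0%R 0%R).
rewrite (walk_density_double_shift k 0%R v) (walk_density_double_shift k v 0%R).
have mm b c : measurable_fun setT (fun y => (p k.+1 (y - b) * p k.+1 (y - c))%:E).
  by apply/measurable_EFinP; exact: measurable_funM.
have pp0 b c y : 0 <= (p k.+1 (y - b) * p k.+1 (y - c))%:E.
  by rewrite lee_fin mulr_ge0.
rewrite -ge0_integralZl// -ge0_integralD//; apply: ge0_le_integral => //.
- by move=> y _; rewrite mule_ge0.
- exact: measurable_funeM.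
- exact: emeasurable_funD.
- move=> y _; rewrite -EFinM -EFinD lee_fin !addr0 !add0r.
  set a := p _ _; set b := p _ (y - v).
  by rewrite -subr_ge0 (_ : _ - _ = (a - b) ^+ 2)%R ?sqr_ge0//; ring.
Qed.

(* Integrating [(f (y - v) + f (y + v) - 2 f y)^2 >= 0]. *)
Lemma walk_density_double_mid k v :
  (4 * p k.+1.*2 v <= 3 * p k.+1.*2 0 + p k.+1.*2 (v *+ 2))%R.
Proof.
suff : (4 * p k.+1.*2 v)%:E + (4 * p k.+1.*2 v)%:E <=
    (6 * p k.+1.*2 0)%:E + (2 * p k.+1.*2 (v *+ 2))%:E.
  by rewrite -!EFinD lee_fin => ?; lra.
have mm b c : measurable_fun setT (fun y => (p k.+1 (y - b) * p k.+1 (y - c))%:E).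
  by apply/measurable_EFinP; exact: measurable_funM.
have pp0 b c y : 0 <= (p k.+1 (y - b) * p k.+1 (y - c))%:E.
  by rewrite lee_fin mulr_ge0.
have -> : (6 * p k.+1.*2 0)%:E = (p k.+1.*2 0)%:E + (4 * p k.+1.*2 0)%:E + (p k.+1.*2 0)%:E.
  by rewrite -!EFinD; congr _%:E; ring.
rewrite !EFinM {1}(walk_density_double_shift k v 0%R).
rewrite (walk_density_double_shift k v (- v)%R).
rewrite (walk_density_double_shift k (v *+ 2)%R (- v)%R).
rewrite {1}(walk_density_double_shift k 0%R (- v)%R).
rewrite {1}(walk_density_double_shift k 0%R 0%R).
rewrite {1}(walk_density_double_shift k 0%R v).
rewrite -!ge0_integralZl// -!ge0_integralD//; first last.
all: try by move=> *; rewrite ?adde_ge0 ?mule_ge0.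
all: try by repeat first [exact: measurable_funeM|apply: emeasurable_funD|exact: mm].
apply: ge0_le_integral => //.
- by move=> *; rewrite ?adde_ge0 ?mule_ge0.
- by repeat first [exact: measurable_funeM|apply: emeasurable_funD|exact: mm].
- by repeat first [exact: measurable_funeM|apply: emeasurable_funD|exact: mm].
- move=> y _; rewrite -!EFinM -!EFinD lee_fin !addr0 !add0r subr0 addNr subr0 opprK.
  rewrite mulr2n addrA addNr add0r.
  set a := p _ y; set b := p _ (y - v); set c := p _ (y + v).
  rewrite -subr_ge0 [X in (0 <= X)%R](_ : _ = (b + c - 2 * a) ^+ 2)%R ?sqr_ge0//; ring.
Qed.

End autocorrelation.

(** * A discrete Nash inequality for the return densities *)

Section diagonal_recursion.
Context {R : realType} {d : nat}.
Local Open Scope ereal_scope.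

Variable rho : 'rV[R]_d -> R.
Hypothesis mrho : measurable_fun setT rho.
Hypothesis rho0 : forall x, (0 <= rho x)%R.
Hypothesis rho1 : \int[lebesgue_rV R d]_x (rho x)%:E = 1.
Hypothesis rhoN : forall x, rho x = rho (- x).
Variable M : R.
Hypothesis rhoM : forall x, (rho x <= M)%R.

Local Notation p := (walk_density rho).
Implicit Types v b y : 'rV[R]_d.

Let p0 k z : (0 <= p k z)%R. Proof. exact: walk_density_ge0. Qed.
Let mp k : measurable_fun setT (p k).
Proof. exact: (measurable_walk_density mrho rho0 rho1 rhoM). Qed.

(** Half of the integral of [(p k.+1 y - p k.+1 (y - v)) ^+ 2] over [y], which explains its sign and
    its at most quadratic growth under doubling of [v]. *)
Let gap k v := (p k.+1.*2 0 - p k.+1.*2 v)%R.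

Let gap_ge0 k v : (0 <= gap k v)%R.
Proof. by rewrite subr_ge0; exact: walk_density_double_le. Qed.

Let mgap k : measurable_fun setT (fun v => (gap k v)%:E).
Proof. by apply/measurable_EFinP; apply: measurable_funB. Qed.

Let gap_int k del := \int[lebesgue_rV R d]_(v in box del) (gap k v)%:E.

(** The factor 4 is the doubling inequality [gap k (2 v) <= 4 gap k v], and [2 ^+ d] is the Jacobian
    of the dilation. *)
Lemma gap_int_double k del :
  gap_int k (2 * del) <= (4 * 2 ^+ d)%:E * gap_int k del.
Proof.
have s0 : (2 : R)%R != 0%R by [].
pose g v := (gap k v)%:E.
have mg del' : measurable_fun setT (g \_ (box del')).
  apply/(measurable_restrictT _ (measurable_box del')).
  exact: measurable_funTS (mgap k).
have g0 del' v : 0 <= (g \_ (box del')) v.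
  by rewrite patchE; case: ifP => // _; rewrite lee_fin.
rewrite /gap_int !(integral_mkcond (box _)).
have := ge0_integral_affine 0%R s0 (mg (2 * del)%R) (g0 _).
rewrite gtr0_norm// => E.
have -> : \int[lebesgue_rV R d]_x (g \_ (box (2 * del))) x =
    (2 ^+ d)%:E * \int[lebesgue_rV R d]_x (g \_ (box (2 * del))) (2 *: x + 0)%R.
  by rewrite E muleA -EFinM mulfV ?mul1e// expf_neq0.
rewrite (mulrC 4%R) EFinM -muleA lee_wpmul2l ?lee_fin ?exprn_ge0//.
rewrite -ge0_integralZl//.
apply: ge0_le_integral => //.
- under eq_fun do rewrite addr0; apply: measurableT_comp => //.
  by apply: measurable_rVZ; exact: measurable_id.
- exact: measurable_funeM.
- move=> v _; rewrite addr0 !patchE.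
  have -> : ((2 *: v)%R \in box (2 * del)) = (v \in box del).
    apply/idP/idP; rewrite !inE => vd i; have := vd i;
      by rewrite mxE normrM gtr0_norm// ler_pM2l.
  case: ifP => _; last by rewrite mule0.
  rewrite -EFinM lee_fin /gap scaler_nat.
  have := walk_density_double_mid mrho rho0 rho1 rhoN rhoM k v.
  by move=> ?; lra.
Qed.

Lemma gap_int_dyadic k del j :
  gap_int k (2 ^+ j * del) <= ((4 * 2 ^+ d) ^+ j)%:E * gap_int k del.
Proof.
elim: j => [|j IH]; first by rewrite !expr0 mul1r mul1e.
rewrite !exprS -mulrA (le_trans (gap_int_double _ _))// [in leRHS]EFinM -muleA.
by rewrite lee_wpmul2l// lee_fin mulr_ge0// exprn_ge0.
Qed.

(** On the box the constant [p k.+1.*2 0] is the gap plus [p k.+1.*2 v], and the latter integrates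
    to at most 1. *)
Lemma diagonal_le_gap_int k del : (0 < del)%R ->
  (p k.+1.*2 0 * (2 * del) ^+ d)%:E <= gap_int k del + 1.
Proof.
move=> del0; rewrite EFinM -(lebesgue_box (d := d) (ltW del0)).
rewrite -integral_cst; last exact: measurable_box.
rewrite -(walk_density_mass mrho rho0 rho1 rhoM k.+1.*2).
apply: (@le_trans _ _ (gap_int k del +
    \int[lebesgue_rV R d]_(v in box del) (p k.+1.*2 v)%:E)).
  rewrite -ge0_integralD//; last 5 first.
  - exact: measurable_box.
  - by move=> v _; rewrite lee_fin.
  - exact: measurable_funTS.
  - by move=> v _; rewrite lee_fin.
  - by apply: measurable_funTS; exact/measurable_EFinP.
  rewrite [leRHS](eq_integral (fun=> (p k.+1.*2 0)%:E))// => v _.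
  by rewrite -EFinD subrK.
rewrite leeD2l//; apply: ge0_subset_integral => //.
- exact: measurable_box.
- exact/measurable_EFinP.
- by move=> v _; rewrite lee_fin.
Qed.

Variables c eps : R.
Hypothesis c0 : (0 < c)%R.
Hypothesis eps0 : (0 < eps)%R.
Hypothesis p2c : forall v, box eps v -> (c <= p 2 v)%R.

(** Two more steps average [p k.+1.*2] against [p 2], so the decrease is the integral of [p 2] times
    the gap; outside the box only nonnegativity of the gap is used. *)
Lemma diagonal_decrement k :
  (p k.+2.*2 0)%:E + c%:E * gap_int k eps <= (p k.+1.*2 0)%:E.
Proof.
have -> : (k.+2.*2 = 2 + k.*2.+2)%N by [].
rewrite (walk_density_add mrho rho0 rho1 rhoM 1 k.*2.+1) /gap_int.
rewrite (integral_mkcond (box eps)).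
have mg : measurable_fun setT ((fun v => (gap k v)%:E) \_ (box eps)).
  apply/(measurable_restrictT _ (measurable_box eps)).
  exact: measurable_funTS (mgap k).
have g0 v : 0 <= ((fun v => (gap k v)%:E) \_ (box eps)) v.
  by rewrite patchE; case: ifP => // _; rewrite lee_fin.
have mf : measurable_fun setT (fun y => (p 2 y * p k.+1.*2 (0 - y))%:E).
  apply/measurable_EFinP; apply: measurable_funM => //.
  by apply: measurableT_comp => //; apply: measurable_rVB.
have f0 y : 0 <= (p 2 y * p k.+1.*2 (0 - y))%:E by rewrite lee_fin mulr_ge0.
rewrite -ge0_integralZl//; last by rewrite lee_fin ltW.
rewrite -ge0_integralD//; last 2 first.
- by move=> v _; rewrite mule_ge0// lee_fin ltW.
- exact: measurable_funeM.
have -> : (p k.+1.*2 0)%:E =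
    \int[lebesgue_rV R d]_y ((p k.+1.*2 0)%:E * (p 2 y)%:E).
  rewrite ge0_integralZl ?lee_fin//.
  - by rewrite (walk_density_mass mrho rho0 rho1 rhoM) mule1.
  - exact/measurable_EFinP.
  - by move=> y _; rewrite lee_fin.
apply: ge0_le_integral => //.
- by move=> v _; rewrite adde_ge0// mule_ge0// lee_fin ltW.
- by apply: emeasurable_funD => //; exact: measurable_funeM.
- by apply: measurable_funeM; exact/measurable_EFinP.
move=> v _; rewrite sub0r (walk_densityN mrho rho0 rhoN) patchE -EFinM.
case: ifPn => [|_]; rewrite ?inE; [move=> veps|].
  rewrite -EFinM -EFinD lee_fin.
  have := p2c veps; have := gap_ge0 k v; rewrite /gap => g cp.
  have : (c * (p k.+1.*2 0 - p k.+1.*2 v) <= p 2 v * (p k.+1.*2 0 - p k.+1.*2 v))%R.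
    by rewrite ler_wpM2r.
  by rewrite !mulrBr => ?; lra.
rewrite (_ : point = 0 :> \bar R)// mule0 adde0 lee_fin mulrC ler_wpM2r//.
exact: (walk_density_double_le mrho rho0 rho1 rhoN rhoM).
Qed.

(** Eliminates the gap integral between the three preceding estimates. The scale [j] stays free, to
    be chosen later as a function of [k]. *)
Lemma diagonal_recursion k j :
  (p k.+1.*2 0 * (2 * (2 ^+ j * eps)) ^+ d <=
   1 + (4 * 2 ^+ d) ^+ j / c * (p k.+1.*2 0 - p k.+2.*2 0))%R.
Proof.
have dec := diagonal_decrement k.
have G0 : 0 <= gap_int k eps.
  by apply: integral_ge0 => v _; rewrite lee_fin.
have Gfin : gap_int k eps \is a fin_num.
  rewrite ge0_fin_numE//.
  have : c%:E * gap_int k eps < +oo.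
    apply: le_lt_trans (ltry (p k.+1.*2 0)%R).
    by apply: le_trans dec; rewrite leeDr// lee_fin.
  move=> cG; rewrite ltey; apply/eqP => G.
  by move: cG; rewrite G gt0_muley ?lte_fin// ltxx.
have jeps0 : (0 < 2 ^+ j * eps)%R by rewrite mulr_gt0 ?exprn_gt0.
have := diagonal_le_gap_int k jeps0.
have := gap_int_dyadic k eps j.
move: dec; rewrite -(fineK Gfin) -!EFinM -EFinD lee_fin => dec dya H.
have {}H := le_trans H (leeD2r 1 dya).
move: H; rewrite -EFinD lee_fin => /le_trans; apply.
rewrite addrC lerD2l -mulrA ler_wpM2l ?exprn_ge0 ?mulr_ge0 ?exprn_ge0//.
by rewrite mulrC ler_pdivlMr// mulrC; lra.
Qed.

End diagonal_recursion.

(** * Discrete derivatives and sums of real powers *)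

Section power_inequalities.
Context {R : realType}.
Implicit Types (x y s t m theta : R).

Lemma powR_expR x s : 0 < x -> x `^ s = expR (s * ln x).
Proof. by move=> x0; rewrite /powR gt_eqF. Qed.

Lemma powRN_le x y s : 0 <= s -> 0 < x -> x <= y -> y `^ (- s) <= x `^ (- s).
Proof.
move=> s0 x0 xy; have y0 := lt_le_trans x0 xy.
rewrite !powRN lef_pV2 ?posrE ?powR_gt0//.
by rewrite ge0_ler_powR ?nnegrE ?(ltW x0) ?(ltW y0).
Qed.

(** From [ln (1 + y) <= y] followed by [1 + y <= expR y], as for the next two lemmas. *)
Lemma powR_step_ge x s : 0 < x -> 0 <= s ->
  x `^ (- s) * (1 - s / x) <= (x + 1) `^ (- s).
Proof.
move=> x0 s0.
have -> : x + 1 = x * (1 + x^-1) by rewrite mulrDr mulr1 mulfV ?gt_eqF.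
have y0 : 0 < 1 + x^-1 by rewrite addr_gt0 ?invr_gt0.
rewrite powRM ?(ltW x0) ?(ltW y0)// ler_wpM2l ?powR_ge0//.
rewrite powR_expR//; apply: le_trans (expR_ge1Dx _).
rewrite lerD2l mulNr lerN2 ler_wpM2l//.
by rewrite le_ln1Dx// (lt_trans (ltrN10 _)) ?invr_gt0.
Qed.

(** Valid on both sides of [theta = 1], at the price of a constant larger than [1 / theta]: the
    bound [(1 - 1/x)^theta <= 1 / (1 + theta/x)] makes the relative increment at least
    [theta / (x + theta)], and [x >= 1]. *)
Lemma powR_pred_le x theta : 1 <= x -> 0 < theta ->
  x `^ (theta - 1) <= (1 + theta) / theta * (x `^ theta - (x - 1) `^ theta).
Proof.
move=> x1 t0; have x0 : 0 < x by exact: lt_le_trans x1.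
have -> : x - 1 = x * (1 - x^-1) by rewrite mulrBr mulr1 mulfV ?gt_eqF.
have ix1 : x^-1 <= 1 by rewrite invf_le1.
rewrite powRM ?(ltW x0) ?subr_ge0// -{1}[x `^ theta]mulr1 -mulrBr.
rewrite powRB ?powRr1 ?(ltW x0) ?(gt_eqF x0) ?implybT//.
rewrite mulrCA ler_wpM2l ?powR_ge0//.
have key : (1 - x^-1) `^ theta <= (1 + theta / x)^-1.
  have [->|n1] := eqVneq x 1.
    by rewrite invr1 subrr powR0 ?gt_eqF// mulr1 invr_ge0 addr_ge0// ltW.
  have y0 : 0 < 1 - x^-1 by rewrite subr_gt0 invf_lt1// lt_neqAle eq_sym n1.
  rewrite powR_expR// -[leLHS]invrK lef_pV2 ?posrE ?invr_gt0 ?expR_gt0//; last first.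
    by rewrite addr_gt0// divr_gt0.
  rewrite -expRN; apply: le_trans (expR_ge1Dx _).
  rewrite lerD2l -mulrN ler_wpM2l ?(ltW t0)// lerNr le_ln1Dx//.
  by rewrite ltrN2 invf_lt1// lt_neqAle eq_sym n1.
have tx0 : 0 < theta / x by rewrite divr_gt0.
apply: (@le_trans _ _ ((1 + theta) / theta * (1 - (1 + theta / x)^-1))).
  have -> : 1 - (1 + theta / x)^-1 = theta / (x + theta) by field; lra.
  rewrite mulrA divfK ?gt_eqF// ler_pdivlMr ?addr_gt0// mulrDr mulVf ?gt_eqF//.
  by rewrite lerD2l -[leRHS]mul1r ler_wpM2r ?(ltW t0).
by rewrite ler_wpM2l ?divr_ge0 ?addr_ge0 ?(ltW t0)// lerD2l lerN2.
Qed.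

Lemma powR_succ_le x s : 0 < x -> 0 < s ->
  (x + 1) `^ (- s - 1) <= s^-1 * (x `^ (- s) - (x + 1) `^ (- s)).
Proof.
move=> x0 s0; set y := x + 1; have y0 : 0 < y by rewrite addr_gt0.
have y1 : y^-1 < 1 by rewrite invf_lt1// /y ltrDr.
have z0 : 0 < 1 - y^-1 by rewrite subr_gt0.
have -> : x = y * (1 - y^-1) by rewrite mulrBr mulr1 mulfV ?gt_eqF// /y addrK.
rewrite powRM ?(ltW y0) ?(ltW z0)// -{2}[y `^ (- s)]mulr1 -mulrBr.
rewrite powRB ?powRr1 ?(ltW y0) ?(gt_eqF y0) ?implybT//.
rewrite mulrCA ler_wpM2l ?powR_ge0// ler_pdivlMl//.
rewrite lerBrDl powR_expR//; apply: le_trans (expR_ge1Dx _).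
rewrite lerD2l mulNr -mulrN ler_wpM2l ?(ltW s0)// lerNr le_ln1Dx//.
by rewrite ltrN2.
Qed.

Lemma sum_powR_near theta N : 0 < theta ->
  \sum_(1 <= k < N.+1) k%:R `^ (theta - 1) <= (1 + theta) / theta * N%:R `^ theta.
Proof.
move=> t0; elim: N => [|N IH].
  by rewrite big_geq// mulr_ge0 ?powR_ge0 ?divr_ge0 ?addr_ge0 ?(ltW t0).
rewrite big_nat_recr//=; apply: le_trans (lerD IH (powR_pred_le _ t0)) _.
  by rewrite ler1n.
by rewrite -{2}natr1 addrK mulrBr addrC subrK.
Qed.

Lemma sum_powR_tail s n N : 0 < s -> (0 < n)%N ->
  \sum_(n.+1 <= k < N) k%:R `^ (- s - 1) <= s^-1 * n%:R `^ (- s).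
Proof.
move=> s0 n0; have [Nn|nN] := leqP N n.+1.
  by rewrite big_geq// mulr_ge0 ?powR_ge0 ?invr_ge0 ?(ltW s0).
apply: (@le_trans _ _
    (\sum_(n.+1 <= k < N) (s^-1 * (- (k%:R `^ (- s)) - - (k.-1%:R `^ (- s)))))).
  rewrite big_nat_cond [leRHS]big_nat_cond; apply: ler_sum => -[//|k] /andP[/andP[nk _] _].
  have k0 : 0 < k%:R :> R by rewrite ltr0n -ltnS (leq_trans _ nk).
  by rewrite opprK [X in _ * X]addrC -[k.+1%:R]natr1 (powR_succ_le k0).
rewrite -mulr_sumr ler_wpM2l ?invr_ge0 ?(ltW s0)//.
rewrite big_add1 /= telescope_sumr; last by rewrite -ltnS prednK ?(ltn_trans _ nN).
by rewrite opprK addrC gerBl powR_ge0.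
Qed.

(** Each term satisfies [1 / (N + 1) <= - ln (1 - 1 / (N + 1)) = ln ((N + 1) / N)], and the
    logarithms telescope. *)
Lemma sum_inv_log n N : (0 < n)%N -> (n <= N)%N ->
  \sum_(n.+1 <= k < N.+1) (k%:R^-1 : R) <= ln (N%:R / n%:R).
Proof.
move=> n0; elim: N => [|N IH]; first by rewrite leqn0 => /eqP E; rewrite E in n0.
rewrite leq_eqVlt => /orP[/eqP<-|]; first by rewrite big_geq// divff ?pnatr_eq0 ?gtn_eqF// ln1.
rewrite ltnS => nN; rewrite big_nat_recr//=.
have N0 : (0 < N)%N by exact: leq_trans nN.
have N0R : 0 < N%:R :> R by rewrite ltr0n.
have S0R : 0 < N.+1%:R :> R by rewrite ltr0n.
have n0R : 0 < n%:R :> R by rewrite ltr0n.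
have -> : N.+1%:R / n%:R = (N%:R / n%:R) * (N.+1%:R / N%:R) :> R.
  by field; rewrite !gt_eqF.
rewrite lnM ?posrE ?divr_gt0// lerD ?IH//.
rewrite -[leRHS]opprK -lnV ?posrE ?divr_gt0// invf_div lerNr.
have -> : N%:R / N.+1%:R = 1 + - N.+1%:R^-1 :> R.
  by rewrite -[N%:R in LHS](addrK 1) natr1 mulrBl divff ?gt_eqF// mul1r.
by rewrite le_ln1Dx// ltrN2 invf_lt1// ltr1n.
Qed.

Lemma dyadic_bracket x : 1 <= x -> exists j, 4 ^+ j <= x < 4 ^+ j.+1.
Proof.
move=> x1; pose P j := 4 ^+ j <= x.
have P0 : exists j, P j by exists 0%N; rewrite /P expr0.
have Pb j : P j -> (j <= Num.bound x)%N.
  move=> Pj; rewrite -(ler_nat R); apply: le_trans (ltW (archi_boundP _)); last first.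
    exact: le_trans x1.
  apply: le_trans Pj; rewrite -natrX ler_nat.
  by apply: ltnW; exact: ltn_expl.
exists (ex_maxn P0 Pb); case: ex_maxnP => j Pj jmax; apply/andP; split => //.
by rewrite ltNge; apply/negP => /jmax; rewrite ltnn.
Qed.

End power_inequalities.

(** * From the Nash recursion to polynomial decay *)

Section diagonal_decay.
Context {R : realType}.

Lemma powR_half_exprn (x : R) d : 0 <= x -> (x ^+ 2) `^ (- (d%:R / 2)) = x ^- d.
Proof.
move=> x0; rewrite -powR_mulrn// -powRrM.
have -> : 2%:R * - (d%:R / 2) = - d%:R :> R by field.
by rewrite powR_invn.
Qed.

(** The hypothesis holds at every scale [j]; choosing [j] in terms of [k] turns it into a
    contraction strong enough for an induction on [u k <= A (k+1)^(-s)] with [s = d / 2]. *)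
Lemma diagonal_recursion_decay d (u : R^nat) (M c eps : R) : (0 < d)%N ->
  0 < c -> 0 < eps -> (forall k, 0 <= u k <= M) ->
  (forall k j, u k * (2 * (2 ^+ j * eps)) ^+ d <=
     1 + (4 * 2 ^+ d) ^+ j / c * (u k - u k.+1)) ->
  exists2 A, 0 < A & forall k, u k <= A * k.+1%:R `^ (- (d%:R / 2)).
Proof.
move=> d0 c0 eps0 uM urec.
have dR0 : 0 < d%:R :> R by rewrite ltr0n.
pose s : R := d%:R / 2; have s0 : 0 < s by rewrite divr_gt0.
pose e := (2 * eps) ^+ d; have e0 : 0 < e by rewrite exprn_gt0// mulr_gt0.
pose B := (c * e)^-1; have B0 : 0 < B by rewrite invr_gt0 mulr_gt0.
(* The hypothesis solved for [u k.+1]: the relative loss at scale [j] is [1 / (B 4^j)], and the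
   volume factor [(2^j)^d] is rewritten as [(4^j)^s]. *)
have rec k j : u k.+1 <= u k - (B * 4 ^+ j)^-1 * u k
    + (B * 4 ^+ j)^-1 * ((4 ^+ j) `^ (- s) / e).
  have j0 : 0 < 2 ^+ j :> R by rewrite exprn_gt0.
  have F0 : 0 < (2 ^+ j) ^+ d * e :> R by rewrite mulr_gt0// exprn_gt0.
  have := urec k j.
  have -> : (2 * (2 ^+ j * eps)) ^+ d = (2 ^+ j) ^+ d * e.
    by rewrite mulrCA exprMn.
  have -> : (4 ^+ j) `^ (- s) = (2 ^+ j) ^- d.
    have -> : 4 = 2 ^+ 2 :> R by ring.
    by rewrite exprAC (powR_half_exprn _ (exprn_ge0 _ _)).
  have -> : (4 * 2 ^+ d) ^+ j = 4 ^+ j * (2 ^+ j) ^+ d :> R.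
    by rewrite exprMn (exprAC 2 d).
  have j40 : 0 < 4 ^+ j :> R by rewrite exprn_gt0.
  have jd0 : 0 < (2 ^+ j) ^+ d :> R by rewrite exprn_gt0.
  move: (4 ^+ j) ((2 ^+ j) ^+ d) j40 jd0 {j0 F0} => q r q0 r0 H.
  rewrite -subr_ge0.
  have -> : u k - (B * q)^-1 * u k + (B * q)^-1 * (r^-1 / e) - u k.+1 =
      c / (q * r) * (1 + q * r / c * (u k - u k.+1) - u k * (r * e)).
    by rewrite /B; field; rewrite !gt_eqF.
  by rewrite mulr_ge0 ?subr_ge0// divr_ge0 ?mulr_ge0 ?ltW.
pose C1 := 4 * d%:R / e * (4 * B * d%:R) `^ s.
have C10 : 0 <= C1 by rewrite mulr_ge0 ?powR_ge0 ?divr_ge0 ?mulr_ge0 ?(ltW e0).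
have step k : B * d%:R <= k.+1%:R -> 
    u k.+1 <= u k * (1 - d%:R / k.+1%:R) + C1 / k.+1%:R * k.+1%:R `^ (- s).
  move=> kB; set K : R := k.+1%:R; have K0 : 0 < K by rewrite ltr0n.
  have Bd0 : 0 < B * d%:R by rewrite mulr_gt0.
  (* This puts [B * 4 ^+ j] between [K / (4 d)] and [K / d]. The contraction is then at least
     [d / K], twice the relative decrease [s / K] of [K^(-s)]. *)
  have /dyadic_bracket[j /andP[j1 j2]] : 1 <= K / (B * d%:R).
    by rewrite ler_pdivlMr// mul1r.
  apply: le_trans (rec k j) _; have j40 : 0 < 4 ^+ j :> R by rewrite exprn_gt0.
  have l1 : d%:R / K <= (B * 4 ^+ j)^-1.
    rewrite -[leLHS]invrK lef_pV2 ?posrE ?invr_gt0 ?divr_gt0 ?mulr_gt0// invf_div.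
    by rewrite mulrC -ler_pdivlMr// -mulrA -invfM (mulrC _ B).
  have l2 : (B * 4 ^+ j)^-1 <= 4 * d%:R / K.
    rewrite -[leRHS]invrK lef_pV2 ?posrE ?invr_gt0 ?divr_gt0 ?mulr_gt0// invf_div.
    move/ltW: j2; rewrite ler_pdivrMr// exprS => j2.
    by rewrite ler_pdivrMr ?mulr_gt0//; apply: le_trans j2 _; rewrite le_eqVlt;
      apply/orP; left; apply/eqP; ring.
  have l3 : (4 ^+ j) `^ (- s) <= (4 * B * d%:R) `^ s * K `^ (- s).
    have Kq : K / (4 * B * d%:R) <= 4 ^+ j.
      move/ltW: j2; rewrite ler_pdivrMr// exprS => j2.
      by rewrite ler_pdivrMr ?mulr_gt0//; apply: le_trans j2 _; rewrite le_eqVlt;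
        apply/orP; left; apply/eqP; ring.
    have q0 : 0 < 4 * B * d%:R by rewrite !mulr_gt0.
    have -> : (4 * B * d%:R) `^ s * K `^ (- s) = (K / (4 * B * d%:R)) `^ (- s).
      rewrite powRM ?invr_ge0 ?(ltW K0) ?(ltW q0)// mulrC; congr (_ * _).
      by rewrite -powR_inv1 ?(ltW q0)// -powRrM mulN1r opprK.
    by apply: powRN_le => //; rewrite ?(ltW s0) ?divr_gt0.
  have uk0 : 0 <= u k by have /andP[] := uM k.
  rewrite mulrBr mulr1 lerD//.
    by rewrite lerD2l lerN2 mulrC ler_wpM2r.
  rewrite /C1.
  have -> : 4 * d%:R / e * (4 * B * d%:R) `^ s / K * K `^ (- s) =
    (4 * d%:R / K) * (((4 * B * d%:R) `^ s * K `^ (- s)) / e).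
    by field; rewrite !gt_eqF.
  apply: ler_pM => //.
  - by rewrite invr_ge0 ltW// mulr_gt0.
  - by rewrite divr_ge0 ?powR_ge0 ?ltW.
  - by rewrite ler_wpM2r// invr_ge0 ltW.
have M0 : 0 <= M by have /andP[u0 uM0] := uM 0%N; exact: le_trans uM0.
(* From [k0] on, the step estimate applies and [1 - d / K] is nonnegative; earlier indices are
   absorbed by the first term of [A]. *)
pose k0 := Num.bound (Num.max (B * d%:R) d%:R).
have k0P : Num.max (B * d%:R) d%:R < k0%:R.
  by apply: archi_boundP; rewrite le_max ler0n orbT.
pose A := M * k0.+1%:R `^ s + 2 * C1 / d%:R + 1.
have A1 : 0 <= 2 * C1 / d%:R by rewrite divr_ge0// mulr_ge0.
have A0 : 0 < A.
  by rewrite ltr_wpDl// addr_ge0// mulr_ge0 ?powR_ge0.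
exists A => //; elim => [|k IH].
  rewrite powR1 mulr1; have /andP[_ /le_trans] := uM 0%N; apply.
  rewrite /A -addrA ler_wpDr//.
    by rewrite addr_ge0.
  rewrite -[leLHS]mulr1 ler_wpM2l//.
  by rewrite -[leLHS](powRr0 k0.+1%:R) ler_powR ?(ltW s0)// ler1n.
have [kk0|k0k] := leqP k.+2 k0.+1.
  have /andP[_ /le_trans] := uM k.+1; apply.
  apply: (@le_trans _ _ (M * k0.+1%:R `^ s * k.+2%:R `^ (- s))).
    rewrite -mulrA -[leLHS]mulr1 ler_wpM2l// powRN ler_pdivlMr ?powR_gt0// mul1r.
    by rewrite ge0_ler_powR ?nnegrE ?ler0n ?(ltW s0)// ler_nat.
  rewrite ler_wpM2r ?powR_ge0// /A -addrA lerDl.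
  by rewrite addr_ge0.
set K : R := k.+1%:R; have K0 : 0 < K by rewrite ltr0n.
have : Num.max (B * d%:R) d%:R <= K.
  by rewrite (le_trans (ltW k0P))// /K ler_nat ltnW.
rewrite ge_max => /andP[BK dK].
have {}step := step _ BK.
have dK1 : 0 <= 1 - d%:R / K by rewrite subr_ge0 ler_pdivrMr// mul1r.
apply: (@le_trans _ _ (A * (K `^ (- s) * (1 - s / K)))); last first.
  by rewrite ler_wpM2l ?(ltW A0)// -[k.+2%:R]natr1 (powR_step_ge K0 (ltW s0)).
apply: le_trans step _.
apply: (@le_trans _ _ (A * K `^ (- s) * (1 - d%:R / K) + C1 / K * K `^ (- s))).
  by rewrite lerD2r ler_wpM2r.
(* The surplus [d - s = s] of the contraction pays for the source term; this is the origin of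
   [2 * C1 / d] in [A]. *)
have C1A : C1 <= A * s.
  have -> : A * s = C1 + (M * k0.+1%:R `^ s + 1) * s.
    by rewrite /A /s; field; rewrite gt_eqF.
  by rewrite lerDl mulr_ge0 ?addr_ge0 ?mulr_ge0 ?powR_ge0 ?(ltW s0).
rewrite -subr_ge0.
have -> : A * (K `^ (- s) * (1 - s / K)) -
    (A * K `^ (- s) * (1 - d%:R / K) + C1 / K * K `^ (- s)) =
    K `^ (- s) / K * (A * s - C1).
  by rewrite /s; field; rewrite gt_eqF.
by rewrite mulr_ge0 ?subr_ge0 ?divr_ge0 ?powR_ge0 ?(ltW K0).
Qed.

End diagonal_decay.

Section uniform_decay.
Context {R : realType} {d : nat}.

Variable rho : 'rV[R]_d -> R.
Hypothesis d0 : (0 < d)%N.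
Hypothesis mrho : measurable_fun setT rho.
Hypothesis rho0 : forall x, 0 <= rho x.
Hypothesis rho1 : (\int[lebesgue_rV R d]_x (rho x)%:E = 1)%E.
Hypothesis rhoN : forall x, rho x = rho (- x).
Variable M : R.
Hypothesis rhoM : forall x, rho x <= M.

Local Notation p := (walk_density rho).

(** Convolution with a probability density does not increase the supremum; this passes from even to
    odd times. *)
Lemma walk_densityS_le k B z : (forall y, p k.+1 y <= B) -> p k.+2 z <= B.
Proof.
move=> pB; have mp := measurable_walk_density mrho rho0 rho1 rhoM.
have B0 : 0 <= B by exact: le_trans (walk_density_ge0 rho0 _ _) (pB 0).
rewrite -lee_fin (_ : k.+2 = 1 + k.+1)%N// (walk_density_add mrho rho0 rho1 rhoM 0 k).
apply: (@le_trans _ _ (\int[lebesgue_rV R d]_y (B%:E * (p 1 y)%:E))%E); last first.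
  rewrite ge0_integralZl//.
  - by rewrite (walk_density_mass mrho rho0 rho1 rhoM) mule1.
  - exact/measurable_EFinP.
  - by move=> y _; rewrite lee_fin walk_density_ge0.
apply: ge0_le_integral => //.
- by move=> y _; rewrite lee_fin mulr_ge0 ?walk_density_ge0.
- apply/measurable_EFinP; apply: measurable_funM => //.
  by apply: measurableT_comp => //; apply: measurable_rVB.
- by apply: measurable_funeM; exact/measurable_EFinP.
- by move=> y _; rewrite -EFinM lee_fin mulrC ler_wpM2r ?walk_density_ge0.
Qed.

Lemma walk_density_decay : exists2 A : R, 0 < A &
  forall k z, p k.+1 z <= A * k.+1%:R `^ (- (d%:R / 2)).
Proof.
have [c [eps [c0 eps0 p2c]]] := walk_density2_lower_bound mrho rho0 rho1 rhoN rhoM.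
have uM k : 0 <= p k.+1.*2 0 <= M.
  by rewrite walk_density_ge0//= (walk_density_le mrho rho0 rho1 rhoM).
have [A A0 uA] := diagonal_recursion_decay d0 c0 eps0 uM
  (diagonal_recursion mrho rho0 rho1 rhoN rhoM c0 eps0 p2c).
have M0 : 0 <= M by exact: le_trans (rho0 0) (rhoM 0).
have s0 : 0 <= d%:R / 2 :> R by rewrite divr_ge0.
exists (A * 3 `^ (d%:R / 2) + M); first by rewrite ltr_pwDl// mulr_gt0// powR_gt0.
(* It is applied to the times [k = 2 (m + 1)] and [2 (m + 1) + 1], both at most [3 (m + 1)];
   replacing [m + 1] by [k] costs [3^(d/2)]. Time 1 is covered by [M]. *)
have half m k z : (k <= m.+1 * 3)%N -> (0 < k)%N -> (forall y, p k y <= p m.+1.*2 0) ->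
    p k z <= (A * 3 `^ (d%:R / 2) + M) * k%:R `^ (- (d%:R / 2)).
  move=> km k0 pk; apply: (le_trans (pk z)); apply: (le_trans (uA m)).
  rewrite mulrDl; apply: ler_wpDr; first by rewrite mulr_ge0// powR_ge0.
  rewrite -mulrA ler_wpM2l ?(ltW A0)//.
  have -> : 3 `^ (d%:R / 2) = 3^-1 `^ (- (d%:R / 2)) :> R.
    by rewrite -[3^-1]powR_inv1// -powRrM mulN1r opprK.
  rewrite -powRM// powRN_le// ?mulr_gt0 ?ltr0n//.
  by rewrite mulrC ler_pdivrMr// -natrM ler_nat.
case=> [|n] z.
  rewrite powR1 mulr1 walk_density1; apply: ler_wpDl => //.
  by rewrite mulr_ge0 ?powR_ge0 ?ltW.
have := odd_double_half n.+2; case: (odd n.+2) => /= [|] E.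
  rewrite -E in z *; apply: (half n./2) => //.
    by rewrite -muln2; lia.
  move=> y; rewrite add1n; apply: walk_densityS_le => w.
  exact: (walk_density_double_le mrho rho0 rho1 rhoN rhoM).
rewrite add0n in E; rewrite -E; apply: (half n./2) => //.
  by rewrite -muln2; lia.
by move=> y; exact: (walk_density_double_le mrho rho0 rho1 rhoN rhoM).
Qed.

End uniform_decay.

(** * Moments and decay off the diagonal *)

Section moment_inequalities.
Context {R : realType}.
Implicit Types (s t x y m K : R).

(** For [y = 2 t >= 0] the excess over 2 is [(expR t - expR (- t)) ^+ 2], and that difference is at
    most [y * expR t]. *)
Lemma expR_sym_le y : expR y + expR (- y) <= 2 + y ^+ 2 * expR `|y|.
Proof.
wlog y0 : y / 0 <= y => [H|].
  have [/H//|/ltW yn] := leP 0 y.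
  have := H (- y); rewrite oppr_ge0 => /(_ yn).
  by rewrite opprK sqrrN normrN addrC.
rewrite ger0_norm//; set t := y / 2.
have yt : y = t + t by rewrite /t; field.
have t0 : 0 <= t by rewrite divr_ge0.
have Et : 0 < expR t by exact: expR_gt0.
have H1 : 0 <= expR t - expR (- t) by rewrite subr_ge0 ler_expR; lra.
have H2 : expR t - expR (- t) <= y * expR t.
  have -> : expR (- t) = expR t * expR (- y).
    by rewrite -expRD yt opprD addrA subrr sub0r.
  rewrite -[X in X - _]mulr1 -mulrBr mulrC ler_wpM2r// ?(ltW Et)//.
  by rewrite lerBlDr -lerBlDl; exact: expR_ge1Dx.
have H3 : (expR t - expR (- t)) ^+ 2 <= (y * expR t) ^+ 2.
  by rewrite lerXn2r ?nnegrE// mulr_ge0 ?(ltW Et).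
have e1 : expR y = expR t ^+ 2 by rewrite yt expRD expr2.
have e2 : expR (- y) = expR (- t) ^+ 2 by rewrite yt opprD expRD expr2.
have e3 : expR t * expR (- t) = 1 by rewrite expRxMexpNx_1.
move: H3; rewrite exprMn sqrrB e3 -e1 -e2 mulr2n; lra.
Qed.

(** The first summand serves increments smaller than the position, the second the crude estimate for
    larger ones. *)
Definition moment_cst m : R := m ^+ 2 * expR m + 2 * 2 `^ m.

Lemma moment_cst_ge0 m : 0 <= moment_cst m.
Proof. by rewrite addr_ge0// mulr_ge0 ?sqr_ge0 ?expR_ge0 ?powR_ge0. Qed.

(** Symmetrisation cancels the first-order term. When [|x| < |s|], put [x = s u] and use
    [(1 + u)^m <= expR (m u)] for both signs of [u]; otherwise both left-hand terms are at most
    [(2 |x|)^m]. *)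
Lemma powR_norm_sym_le m s x : 2 <= m ->
  `|s + x| `^ m + `|s - x| `^ m <=
  2 * `|s| `^ m + moment_cst m * (`|s| `^ (m - 2) * x ^+ 2 + `|x| `^ m).
Proof.
move=> m2; have m0 : 0 <= m by lra.
have [xs|sx] := ltP `|x| `|s|; last first.
  have bnd z : `|z| <= 2 * `|x| -> `|z| `^ m <= 2 `^ m * `|x| `^ m.
    by move=> zx; rewrite -powRM//; apply: ge0_ler_powR; rewrite ?nnegrE ?mulr_ge0.
  have b1 : `|s + x| `^ m <= 2 `^ m * `|x| `^ m.
    by apply: bnd; rewrite (le_trans (ler_normD _ _))//; lra.
  have b2 : `|s - x| `^ m <= 2 `^ m * `|x| `^ m.
    by apply: bnd; rewrite (le_trans (ler_normB _ _))//; lra.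
  apply: (le_trans (lerD b1 b2)); apply: ler_wpDl; first by rewrite mulr_ge0 ?powR_ge0.
  rewrite mulrDr; apply: ler_wpDl.
    by rewrite mulr_ge0 ?moment_cst_ge0// mulr_ge0 ?powR_ge0 ?sqr_ge0.
  rewrite /moment_cst mulrDl; apply: ler_wpDl.
    by rewrite mulr_ge0 ?powR_ge0// mulr_ge0 ?sqr_ge0 ?expR_ge0.
  by rewrite -mulrA mulr2n !mulrDl !mul1r.
have s0 : s != 0 by rewrite -normr_gt0 (le_lt_trans _ xs).
have as0 : 0 < `|s| by rewrite normr_gt0.
have [u xu] : exists u, x = s * u by exists (x / s); rewrite mulrC divfK.
have u1 : `|u| < 1 by move: xs; rewrite xu normrM -[ltRHS]mulr1 ltr_pM2l.
have /andP[uN1 uP1] : - 1 < u < 1 by rewrite -ltr_norml.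
have A0 : 0 < 1 + u by lra.
have B0 : 0 < 1 - u by lra.
have Ale : (1 + u) `^ m <= expR (m * u).
  by rewrite powR_expR// ler_expR ler_wpM2l// le_ln1Dx.
have Ble : (1 - u) `^ m <= expR (- (m * u)).
  by rewrite powR_expR// ler_expR -(mulrN m) ler_wpM2l// le_ln1Dx//; lra.
have AB : (1 + u) `^ m + (1 - u) `^ m <= 2 + m ^+ 2 * expR m * u ^+ 2.
  apply: (le_trans (lerD Ale Ble)); apply: (le_trans (expR_sym_le _)).
  rewrite lerD2l exprMn -(mulrA (m ^+ 2) (u ^+ 2)) -(mulrA (m ^+ 2) (expR m)) ler_wpM2l ?sqr_ge0// (mulrC (u ^+ 2)) ler_wpM2r ?sqr_ge0//.
  by rewrite ler_expR normrM (ger0_norm m0) -[leRHS]mulr1 ler_wpM2l// ltW.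
have -> : `|s + x| = `|s| * (1 + u).
  by rewrite xu -{1}[s]mulr1 -mulrDr normrM (gtr0_norm A0).
have -> : `|s - x| = `|s| * (1 - u).
  by rewrite xu -{1}[s]mulr1 -mulrBr normrM (gtr0_norm B0).
rewrite !powRM ?(ltW A0) ?(ltW B0)// -mulrDr.
apply: (@le_trans _ _ (`|s| `^ m * (2 + m ^+ 2 * expR m * u ^+ 2))).
  by rewrite ler_wpM2l ?powR_ge0.
have su : `|s| `^ m * u ^+ 2 = `|s| `^ (m - 2) * x ^+ 2.
  rewrite powRB ?(gt_eqF as0) ?implybT// powR_mulrn// xu exprMn -normrX.
  by rewrite (ger0_norm (sqr_ge0 _)) (mulrA _ (s ^+ 2)) divfK// expf_neq0.
have -> : `|s| `^ m * (2 + m ^+ 2 * expR m * u ^+ 2) =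
    2 * `|s| `^ m + m ^+ 2 * expR m * (`|s| `^ (m - 2) * x ^+ 2).
  by rewrite -su; ring.
rewrite lerD2l; apply: ler_pM.
- by rewrite mulr_ge0 ?sqr_ge0 ?expR_ge0.
- by rewrite mulr_ge0 ?sqr_ge0 ?powR_ge0.
- by rewrite /moment_cst lerDl mulr_ge0 ?powR_ge0.
- by rewrite lerDl powR_ge0.
Qed.

(** Trades the exponent [m - 2] for a small multiple of the exponent [m] plus a constant, so that
    the moment recursion closes on the [m]-th moment alone. *)
Lemma powR_norm_interp m s K : 2 <= m -> 0 < K ->
  `|s| `^ (m - 2) <= `|s| `^ m / K + K `^ (m / 2 - 1).
Proof.
move=> m2 K0; have [sK|Ks] := ltP (`|s| ^+ 2) K.
  apply: ler_wpDl; first by rewrite divr_ge0 ?powR_ge0 ?ltW.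
  have -> : m - 2 = 2%:R * (m / 2 - 1) by field.
  rewrite powRrM powR_mulrn// ge0_ler_powR ?nnegrE ?sqr_ge0 ?(ltW sK) ?(ltW K0)//.
  by lra.
have s0 : 0 < `|s|.
  by rewrite lt_neqAle normr_ge0 andbT; apply/eqP => E; move: Ks; rewrite -E expr0n/=; lra.
apply: ler_wpDr; first exact: powR_ge0.
rewrite powRB ?(gt_eqF s0) ?implybT// powR_mulrn// ler_wpM2l ?powR_ge0//.
by rewrite lef_pV2 ?posrE ?exprn_gt0.
Qed.

End moment_inequalities.

(** * Growth of the moments of the walk *)

Section walk_moments.
Context {R : realType} {d : nat}.
Local Open Scope ereal_scope.

Variable rho : 'rV[R]_d -> R.
Hypothesis mrho : measurable_fun setT rho.
Hypothesis rho0 : forall x, (0 <= rho x)%R.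
Hypothesis rho1 : \int[lebesgue_rV R d]_x (rho x)%:E = 1.
Hypothesis rhoN : forall x, rho x = rho (- x).
Variable M : R.
Hypothesis rhoM : forall x, (rho x <= M)%R.

Local Notation p := (walk_density rho).

Let p0 k z : (0 <= p k z)%R. Proof. exact: walk_density_ge0. Qed.
Let mp k : measurable_fun setT (p k).
Proof. exact: (measurable_walk_density mrho rho0 rho1 rhoM). Qed.

Variables (i : 'I_d) (m v mu : R).
Hypothesis m2 : (2 <= m)%R.
Hypothesis rho_var : \int[lebesgue_rV R d]_x (x ord0 i ^+ 2 * rho x)%:E = v%:E.
Hypothesis rho_mom : \int[lebesgue_rV R d]_x (`|x ord0 i| `^ m * rho x)%:E = mu%:E.

Let h (x : 'rV[R]_d) : R := (`|x ord0 i| `^ m)%R.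
Let mom k := \int[lebesgue_rV R d]_x (h x * p k x)%:E.

Let h0 x : (0 <= h x)%R. Proof. exact: powR_ge0. Qed.

Let mh : measurable_fun setT h.
Proof.
apply: (measurableT_comp (f := fun t : R => (t `^ m)%R)) => //.
apply: (measurableT_comp (f := @Num.norm R R)); first exact: normr_measurable.
exact: measurable_coord_rV.
Qed.

Let v0 : (0 <= v)%R.
Proof.
rewrite -lee_fin -rho_var; apply: integral_ge0 => x _.
by rewrite lee_fin mulr_ge0 ?sqr_ge0.
Qed.

Let mu0 : (0 <= mu)%R.
Proof.
by rewrite -lee_fin -rho_mom; apply: integral_ge0 => x _; rewrite lee_fin mulr_ge0.
Qed.

(** Conditioning on the position [y] before the last step [w]. *)
Let mom_split k : mom k.+2 = \int[lebesgue_rV R d]_y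
  ((p k.+1 y)%:E * \int[lebesgue_rV R d]_w (h (y + w) * rho w)%R%:E).
Proof.
have mps : measurable_fun setT
    (fun q : 'rV[R]_d * 'rV[R]_d => (h q.1 * (p k.+1 q.2 * rho (q.1 - q.2)))%:E).
  apply/measurable_EFinP; apply: measurable_funM.
    exact: measurableT_comp mh measurable_fst.
  apply: measurable_funM; first exact: measurableT_comp (mp _) measurable_snd.
  by apply: measurableT_comp => //; exact: measurable_rVB.
transitivity (\int[lebesgue_rV R d]_x \int[lebesgue_rV R d]_y
    (h x * (p k.+1 y * rho (x - y)))%:E).
  apply: eq_integral => x _; rewrite -(addn1 k.+1) EFinM.
  rewrite (walk_density_add mrho rho0 rho1 rhoM k 0) -ge0_integralZl ?lee_fin//.
  - by apply: eq_integral => y _; rewrite -EFinM walk_density1.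
  - apply/measurable_EFinP; apply: measurable_funM => //.
    by apply: measurableT_comp => //; exact: measurable_rVB.
  - by move=> y _; rewrite lee_fin mulr_ge0.
rewrite (tonelli_rV (K := fun x y => (h x * (p k.+1 y * rho (x - y)))%:E))//; last first.
  by move=> x y; rewrite lee_fin !mulr_ge0.
apply: eq_integral => y _.
have mh1 : measurable_fun setT (fun w : 'rV[R]_d => (h (y + w) * rho w)%:E).
  apply/measurable_EFinP; apply: measurable_funM => //.
  by apply: measurableT_comp => //; exact: measurable_rVD.
rewrite -ge0_integralZl ?lee_fin//; last by move=> w _; rewrite lee_fin mulr_ge0.
rewrite -[RHS](ge0_integral_comp_sub y).
- by apply: eq_integral => w _; rewrite -EFinM (addrC y) subrK mulrCA.
- exact: measurable_funeM.
- by move=> w; rewrite -EFinM lee_fin !mulr_ge0.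
Qed.

Let mom_reflect y : \int[lebesgue_rV R d]_w (h (y + w) * rho w)%R%:E =
  \int[lebesgue_rV R d]_w (h (y - w) * rho w)%R%:E.
Proof.
rewrite -[LHS](ge0_integral_comp_rsub 0).
- by apply: eq_integral => w _; rewrite sub0r -rhoN.
- apply/measurable_EFinP; apply: measurable_funM => //.
  by apply: measurableT_comp => //; exact: measurable_rVD.
- by move=> w; rewrite lee_fin mulr_ge0.
Qed.

Let C := moment_cst m.

(** By symmetry of [rho] the doubled integral averages [h (y + w) + h (y - w)], to which the
    symmetric Taylor bound applies; the interpolation at level [K] then removes the exponent
    [m - 2]. *)
Let mom_step_pointwise K y : (0 < K)%R ->
  \int[lebesgue_rV R d]_w (h (y + w) * rho w)%R%:E +
  \int[lebesgue_rV R d]_w (h (y + w) * rho w)%R%:E <=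
  (2 * h y + C * (v * (h y / K + K `^ (m / 2 - 1)) + mu))%:E.
Proof.
move=> K0; rewrite {2}mom_reflect.
have C0 : (0 <= C)%R by exact: moment_cst_ge0.
set b := (h y / K + K `^ (m / 2 - 1))%R.
have b0 : (0 <= b)%R by rewrite addr_ge0 ?powR_ge0// divr_ge0 ?h0 ?ltW.
have mhr : measurable_fun setT (fun w => (h w * rho w)%:E).
  by apply/measurable_EFinP; exact: measurable_funM.
have mvr : measurable_fun setT (fun w : 'rV[R]_d => (w ord0 i ^+ 2 * rho w)%:E).
  apply/measurable_EFinP; apply: measurable_funM => //.
  by apply: measurable_funX; exact: measurable_coord_rV.
have mr : measurable_fun setT (fun w => (rho w)%:E) by exact/measurable_EFinP.
have -> : (2 * h y + C * (v * b + mu))%:E = \int[lebesgue_rV R d]_w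
    ((2 * h y)%:E * (rho w)%:E + (C * b)%:E * (w ord0 i ^+ 2 * rho w)%:E +
     C%:E * (h w * rho w)%:E).
  have hy0 : 0 <= (2 * h y)%:E by rewrite lee_fin mulr_ge0.
  have Cb0 : 0 <= (C * b)%:E by rewrite lee_fin mulr_ge0.
  have C0E : 0 <= C%:E by rewrite lee_fin.
  have r0 w : 0 <= (rho w)%:E by rewrite lee_fin.
  have vr0 (w : 'rV[R]_d) : 0 <= (w ord0 i ^+ 2 * rho w)%:E.
    by rewrite lee_fin mulr_ge0 ?sqr_ge0.
  have hr0 w : 0 <= (h w * rho w)%:E by rewrite lee_fin mulr_ge0.
  rewrite ge0_integralD//.
  - rewrite ge0_integralD//.
    + rewrite !ge0_integralZl// rho1 rho_var rho_mom mule1 -!EFinM -!EFinD.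
      by congr _%:E; ring.
    + by move=> w _; rewrite mule_ge0.
    + exact: measurable_funeM.
    + by move=> w _; rewrite mule_ge0.
    + exact: measurable_funeM.
  - by move=> w _; rewrite adde_ge0 ?mule_ge0.
  - by apply: emeasurable_funD; exact: measurable_funeM.
  - by move=> w _; rewrite mule_ge0.
  - exact: measurable_funeM.
have mhD : measurable_fun setT (fun w : 'rV[R]_d => (h (y + w) * rho w)%:E).
  apply/measurable_EFinP; apply: measurable_funM => //.
  by apply: measurableT_comp => //; exact: measurable_rVD.
have mhB : measurable_fun setT (fun w : 'rV[R]_d => (h (y - w) * rho w)%:E).
  apply/measurable_EFinP; apply: measurable_funM => //.
  by apply: measurableT_comp => //; exact: measurable_rVB.
rewrite -ge0_integralD//; last 2 first.
- by move=> w _; rewrite lee_fin mulr_ge0.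
- by move=> w _; rewrite lee_fin mulr_ge0.
apply: ge0_le_integral => //.
- by move=> w _; rewrite adde_ge0// lee_fin mulr_ge0.
- exact: emeasurable_funD.
- by do 2?apply: emeasurable_funD; exact: measurable_funeM.
move=> w _; rewrite -!EFinM -!EFinD lee_fin -mulrDl.
have := powR_norm_sym_le (y ord0 i) (w ord0 i) m2.
have := powR_norm_interp (y ord0 i) m2 K0; rewrite -/(h y) -/b => H1 H2.
have -> : (2 * h y * rho w + C * b * (w ord0 i ^+ 2 * rho w) + C * (h w * rho w) =
  (2 * h y + C * (b * w ord0 i ^+ 2 + h w)) * rho w)%R by ring.
rewrite ler_wpM2r//; apply: (@le_trans _ _ (2 * h y + moment_cst m *
   (`|y ord0 i| `^ (m - 2) * w ord0 i ^+ 2 + h w))%R).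
  by move: H2; rewrite /h !mxE.
by rewrite lerD2l ler_wpM2l// lerD2r ler_wpM2r ?sqr_ge0.
Qed.

Let mom_step k K (B : R) : (0 < K)%R -> mom k.+1 <= B%:E ->
  mom k.+2 <= ((1 + C * v / 2 / K) * B + C * (v * K `^ (m / 2 - 1) + mu) / 2)%:E.
Proof.
move=> K0 momB.
have C0 : (0 <= C)%R by exact: moment_cst_ge0.
suff : mom k.+2 + mom k.+2 <=
    ((2 + C * v / K) * B + C * (v * K `^ (m / 2 - 1) + mu))%:E.
  have : 0 <= mom k.+2 by apply: integral_ge0 => x _; rewrite lee_fin mulr_ge0.
  case: (mom k.+2) => // r _; rewrite -EFinD !lee_fin => H.
  by rewrite -(ler_pM2l (ltr0n _ 2)) mulr_natl mulr2n (le_trans H)// le_eqVlt;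
    apply/orP; left; apply/eqP; field; rewrite gt_eqF.
have mG : measurable_fun setT
    (fun y : 'rV[R]_d => \int[lebesgue_rV R d]_w (h (y + w) * rho w)%R%:E).
  apply: (measurable_fun_fubini_tonelli_F
    (fun q : 'rV[R]_d * 'rV[R]_d => (h (q.1 + q.2) * rho q.2)%:E)).
    apply/measurable_EFinP; apply: measurable_funM.
      by apply: measurableT_comp => //; exact: measurable_rVD.
    exact: measurableT_comp mrho measurable_snd.
  by move=> q; rewrite lee_fin mulr_ge0.
have G0 (y : 'rV[R]_d) : 0 <= \int[lebesgue_rV R d]_w (h (y + w) * rho w)%R%:E.
  by apply: integral_ge0 => w _; rewrite lee_fin mulr_ge0.
have mpE k' : measurable_fun setT (fun y : 'rV[R]_d => (p k' y)%:E) by exact/measurable_EFinP.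
have pE0 k' y : 0 <= (p k' y)%:E by rewrite lee_fin.
have mhp : measurable_fun setT (fun y : 'rV[R]_d => (h y * p k.+1 y)%:E).
  by apply/measurable_EFinP; exact: measurable_funM.
have hp0 y : 0 <= (h y * p k.+1 y)%:E by rewrite lee_fin mulr_ge0.
have a0 : (0 <= 2 + C * v / K)%R by rewrite addr_ge0// divr_ge0 ?(ltW K0)// mulr_ge0.
have b0 : (0 <= C * (v * K `^ (m / 2 - 1) + mu))%R.
  by rewrite mulr_ge0// addr_ge0// mulr_ge0// powR_ge0.
rewrite mom_split -ge0_integralD//; last 4 first.
- by move=> y _; rewrite mule_ge0.
- exact: emeasurable_funM.
- by move=> y _; rewrite mule_ge0.
- exact: emeasurable_funM.
apply: (@le_trans _ _ (\int[lebesgue_rV R d]_y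
   ((2 + C * v / K)%:E * (h y * p k.+1 y)%:E +
    (C * (v * K `^ (m / 2 - 1) + mu))%:E * (p k.+1 y)%:E))).
  apply: ge0_le_integral => //.
  - by move=> y _; rewrite adde_ge0 ?mule_ge0.
  - by apply: emeasurable_funD; exact: emeasurable_funM.
  - by apply: emeasurable_funD; exact: measurable_funeM.
  move=> y _; rewrite -ge0_muleDr//.
  apply: le_trans (lee_wpmul2l (pE0 _ _) (mom_step_pointwise y K0)) _.
  rewrite -!EFinM -EFinD lee_fin le_eqVlt; apply/orP; left; apply/eqP; ring.
rewrite ge0_integralD//; last 4 first.
- by move=> y _; rewrite mule_ge0.
- exact: measurable_funeM.
- by move=> y _; rewrite mule_ge0.
- exact: measurable_funeM.
rewrite !ge0_integralZl// (walk_density_mass mrho rho0 rho1 rhoM) mule1 [leRHS]EFinD.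
by rewrite leeD2r// [leRHS]EFinM lee_wpmul2l.
Qed.

(* For a fixed horizon [K] the recursion loses a factor [1 + O(1/K)] per step. *)
Lemma walk_moment_le : exists2 B : R, (0 <= B)%R & forall k,
  \int[lebesgue_rV R d]_x (`|x ord0 i| `^ m * p k.+1 x)%:E <=
  (B * k.+1%:R `^ (m / 2))%:E.
Proof.
have C0 : (0 <= C)%R by exact: moment_cst_ge0.
pose a := (C * v / 2)%R; pose b := (C * (v + mu) / 2)%R.
have a0 : (0 <= a)%R by rewrite divr_ge0// mulr_ge0.
have b0 : (0 <= b)%R by rewrite divr_ge0// mulr_ge0// addr_ge0.
have horizon (N : nat) k : (0 < N)%N -> mom k.+1 <=
    ((1 + a / N%:R) ^+ k * (mu + k%:R * (b * N%:R `^ (m / 2 - 1))))%:E.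
  move=> N0; have NR0 : (0 < N%:R :> R)%R by rewrite ltr0n.
  have N1 : (1 <= N%:R :> R)%R by rewrite ler1n.
  have aN : (0 <= a / N%:R)%R by rewrite divr_ge0.
  set w := (b * N%:R `^ (m / 2 - 1))%R.
  have w0 : (0 <= w)%R by rewrite mulr_ge0 ?powR_ge0.
  elim: k => [|k IH].
    rewrite expr0 mul0r addr0 mul1r -rho_mom le_eqVlt; apply/orP; left; apply/eqP.
    by apply: eq_integral => x _; rewrite walk_density1.
  apply: le_trans (mom_step NR0 IH) _; rewrite lee_fin -/a.
  have q1 : (1 <= (1 + a / N%:R) ^+ k.+1)%R by rewrite exprn_ege1// lerDl.
  have -> : ((1 + a / N%:R) ^+ k.+1 * (mu + k.+1%:R * w) =
      (1 + a / N%:R) * ((1 + a / N%:R) ^+ k * (mu + k%:R * w)) +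
      (1 + a / N%:R) ^+ k.+1 * w)%R.
    by rewrite exprS -natr1; ring.
  rewrite lerD2l; apply: (@le_trans _ _ w); last by rewrite ler_peMl.
  rewrite /w /b [leRHS]mulrAC ler_wpM2r//.
  rewrite -mulrA ler_wpM2l// mulrDl lerD2l -[leLHS]mulr1 ler_wpM2l//.
  rewrite -[leLHS](powRr0 N%:R) ler_powR// subr_ge0 ler_pdivlMr// mul1r.
  exact: m2.
exists (expR a * (mu + b))%R; first by rewrite mulr_ge0 ?expR_ge0// addr_ge0.
move=> k; apply: le_trans (horizon k.+1 k isT) _; rewrite lee_fin -mulrA.
have k1 : (1 <= k.+1%:R :> R)%R by rewrite ler1n.
have kw : (k%:R * (b * k.+1%:R `^ (m / 2 - 1)) <= b * k.+1%:R `^ (m / 2))%R.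
  rewrite mulrCA ler_wpM2l// powRB ?powRr1 ?pnatr_eq0 ?implybT// mulrA.
  by rewrite ler_pdivrMr ?ltr0n// mulrC ler_wpM2l ?powR_ge0// ler_nat.
apply: ler_pM.
- by rewrite exprn_ge0// addr_ge0// divr_ge0.
- by rewrite addr_ge0// mulr_ge0// mulr_ge0 ?powR_ge0.
- apply: (@le_trans _ _ (expR (a / k.+1%:R) ^+ k))%R.
    rewrite lerXn2r ?nnegrE ?expR_ge0 ?expR_ge1Dx//.
    by rewrite addr_ge0// divr_ge0.
  rewrite -expRM_natl ler_expR mulrA ler_pdivrMr ?ltr0n// mulrC ler_wpM2l//.
  by rewrite ler_nat.
rewrite mulrDl lerD// -[leLHS]mulr1 ler_wpM2l//.
by rewrite -[leLHS](powRr0 k.+1%:R) ler_powR// divr_ge0// (le_trans _ m2).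
Qed.

End walk_moments.

(** * The Euclidean norm and its balls *)

Section enorm_facts.
Context {R : realType} {d : nat}.
Implicit Types x : 'rV[R]_d.

Lemma enorm_ge0 x : 0 <= enorm x. Proof. exact: sqrtr_ge0. Qed.

Lemma le_enorm x i : `|x ord0 i| <= enorm x.
Proof.
rewrite /enorm -sqrtr_sqr ler_sqrt; last by rewrite sumr_ge0// => j _; rewrite sqr_ge0.
by rewrite (bigD1 i)//= lerDl sumr_ge0// => j _; rewrite sqr_ge0.
Qed.

Lemma enorm_le_coord x : (0 < d)%N -> exists i, enorm x <= d%:R * `|x ord0 i|.
Proof.
move=> d0; pose i := [arg max_(j > Ordinal d0) `|x ord0 j|]%O.
exists i; have xi j : `|x ord0 j| <= `|x ord0 i|.
  by rewrite /i; case: Order.TotalTheory.arg_maxP => // k _; apply.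
rewrite -[leRHS]ger0_norm ?mulr_ge0// -sqrtr_sqr ler_sqrt ?sqr_ge0//.
apply: (@le_trans _ _ (\sum_(j < d) x ord0 i ^+ 2)).
  apply: ler_sum => j _; rewrite -(real_normK (num_real (x ord0 j))) -(real_normK (num_real (x ord0 i))).
  by rewrite lerXn2r ?nnegrE.
rewrite sumr_const card_ord exprMn (real_normK (num_real _)) -[leLHS]mulr_natl ler_wpM2r ?sqr_ge0//.
by rewrite -natrX ler_nat; apply: leq_pmulr.
Qed.

Lemma enorm_eq0 x : (enorm x == 0) = (x == 0).
Proof.
apply/eqP/eqP => [x0|->]; last first.
  by rewrite /enorm big1 ?sqrtr0// => i _; rewrite mxE expr0n.
apply/rowP => i; rewrite mxE; apply/eqP; rewrite -normr_eq0 eq_le normr_ge0 andbT.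
by rewrite -x0 le_enorm.
Qed.

Lemma enormZ (r : R) x : 0 <= r -> enorm (r *: x) = r * enorm x.
Proof.
move=> r0; rewrite /enorm (eq_bigr (fun i => r ^+ 2 * x ord0 i ^+ 2)); last first.
  by move=> i _; rewrite mxE exprMn.
by rewrite -mulr_sumr sqrtrM ?sqr_ge0// sqrtr_sqr ger0_norm.
Qed.

Lemma eball_sub_box (a : R) : eball a `<=` @box R d a.
Proof. by move=> x xa i; rewrite (le_trans (le_enorm x i))// ltW. Qed.

Lemma measurable_eball (a : R) : measurable (eball a : set 'rV[R]_d).
Proof.
have [a0|a0] := leP a 0.
  rewrite (_ : eball a = set0)// -subset0 => x /=; rewrite /eball/=.
  by rewrite ltNge (le_trans a0) ?enorm_ge0.
have m : measurable_fun setT (fun x : 'rV[R]_d => \sum_(i < d) x ord0 i ^+ 2).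
  apply: measurable_sum => i; apply: measurable_funX; exact: measurable_coord_rV.
have := m measurableT _ (measurable_itv `]-oo, (a ^+ 2)[).
rewrite setTI; congr measurable; apply/seteqP; split => x /=; rewrite in_itv/= /eball/= /enorm.
  move=> xa; rewrite -(ltr_pXn2r (ltn0Sn 1)) ?nnegrE ?sqrtr_ge0 ?ltW//.
  by rewrite sqr_sqrtr// sumr_ge0// => j _; rewrite sqr_ge0.
rewrite -(ltr_pXn2r (ltn0Sn 1)) ?nnegrE ?sqrtr_ge0 ?(ltW a0)//.
by rewrite sqr_sqrtr// sumr_ge0// => j _; rewrite sqr_ge0.
Qed.

Lemma lebesgue_eball_le (a : R) : 0 <= a ->
  (lebesgue_rV R d (eball a) <= ((2 * a) ^+ d)%:E)%E.
Proof.
move=> a0; rewrite -lebesgue_box//; apply: le_measure; rewrite ?inE//.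
- exact: measurable_eball.
- exact: measurable_box.
- exact: eball_sub_box.
Qed.

End enorm_facts.

(** * Pointwise decay away from the origin *)

Section off_diagonal.
Context {R : realType} {d : nat}.
Local Open Scope ereal_scope.

Variable rho : 'rV[R]_d -> R.
Hypothesis d0 : (0 < d)%N.
Hypothesis mrho : measurable_fun setT rho.
Hypothesis rho0 : forall x, (0 <= rho x)%R.
Hypothesis rho1 : \int[lebesgue_rV R d]_x (rho x)%:E = 1.
Hypothesis rhoN : forall x, rho x = rho (- x).
Variable M : R.
Hypothesis rhoM : forall x, (rho x <= M)%R.

Local Notation p := (walk_density rho).

Let p0 k z : (0 <= p k z)%R. Proof. exact: walk_density_ge0. Qed.
Let mp k : measurable_fun setT (p k).
Proof. exact: (measurable_walk_density mrho rho0 rho1 rhoM). Qed.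

Lemma measurable_coord_powR (m : R) (i : 'I_d) :
  measurable_fun setT (fun x : 'rV[R]_d => (`|x ord0 i| `^ m)%R).
Proof.
apply: (measurableT_comp (f := fun t : R => (t `^ m)%R)) => //.
apply: (measurableT_comp (f := @Num.norm R R)); first exact: normr_measurable.
exact: measurable_coord_rV.
Qed.

Lemma powR_normD_le (m s t : R) : (0 <= m)%R ->
  (`|s + t| `^ m <= 2 `^ m * (`|s| `^ m + `|t| `^ m))%R.
Proof.
move=> m0; wlog st : s t / (`|s| <= `|t|)%R => [H|].
  have [/H//|/ltW/H] := leP `|s|%R `|t|%R.
  by rewrite addrC [(`|t| `^ m + _)%R]addrC.
apply: (@le_trans _ _ ((2 * `|t|) `^ m)%R).
  apply: ge0_ler_powR; rewrite ?nnegrE ?mulr_ge0//.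
  by rewrite (le_trans (ler_normD _ _))//; lra.
by rewrite powRM// ler_wpM2l ?powR_ge0// lerDr powR_ge0.
Qed.

Lemma walk_density_coord_le (m S Q : R) i j l (z : 'rV[R]_d) : (0 <= m)%R ->
  (forall y, p j.+1 y <= S)%R -> (forall y, p l.+1 y <= S)%R ->
  \int[lebesgue_rV R d]_x (`|x ord0 i| `^ m * p j.+1 x)%:E <= Q%:E ->
  \int[lebesgue_rV R d]_x (`|x ord0 i| `^ m * p l.+1 x)%:E <= Q%:E ->
  (`|z ord0 i| `^ m * p (j.+1 + l.+1) z <= 2 `^ m * (2 * S * Q))%R.
Proof.
move=> m0 pjS plS Qj Ql.
have S0 : (0 <= S)%R by exact: le_trans (p0 _ 0%R) (pjS 0%R).
have mc := measurable_coord_powR m i.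
have mcE k : measurable_fun setT (fun x : 'rV[R]_d => (`|x ord0 i| `^ m * p k x)%:E).
  by apply/measurable_EFinP; exact: measurable_funM.
have cE0 k (x : 'rV[R]_d) : 0 <= (`|x ord0 i| `^ m * p k x)%:E.
  by rewrite lee_fin mulr_ge0 ?powR_ge0.
rewrite -lee_fin EFinM (walk_density_add mrho rho0 rho1 rhoM).
have mz (f : 'rV[R]_d -> \bar R) : measurable_fun setT f ->
    measurable_fun setT (fun y : 'rV[R]_d => f (z - y)%R).
  by move=> mf; apply: measurableT_comp => //; exact: measurable_rVB.
rewrite -ge0_integralZl ?lee_fin ?powR_ge0//; last 2 first.
- apply/measurable_EFinP; apply: measurable_funM => //.
  by apply: measurableT_comp => //; exact: measurable_rVB.
- by move=> y _; rewrite lee_fin mulr_ge0.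
have -> : (2 `^ m * (2 * S * Q))%R%:E =
    (2 `^ m * S)%R%:E * Q%:E + (2 `^ m * S)%R%:E * Q%:E.
  by rewrite -!EFinM -EFinD; congr _%:E; ring.
have k0 : 0 <= (2 `^ m * S)%R%:E by rewrite lee_fin mulr_ge0 ?powR_ge0.
apply: (@le_trans _ _ (\int[lebesgue_rV R d]_y
   ((2 `^ m * S)%R%:E * (`|y ord0 i| `^ m * p j.+1 y)%:E +
    (2 `^ m * S)%R%:E * (`|(z - y)%R ord0 i| `^ m * p l.+1 (z - y))%:E))).
  apply: ge0_le_integral => //.
  - by move=> y _; rewrite -EFinM lee_fin mulr_ge0 ?powR_ge0// mulr_ge0.
  - apply: measurable_funeM; apply/measurable_EFinP; apply: measurable_funM => //.
    by apply: measurableT_comp => //; exact: measurable_rVB.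
  - apply: emeasurable_funD; first exact: measurable_funeM.
    by apply: measurable_funeM; exact: (mz _ (mcE l.+1)).
  move=> y _; rewrite -!EFinM -EFinD lee_fin.
  set a := (`|y ord0 i| `^ m)%R; set b := (`|(z - y)%R ord0 i| `^ m)%R.
  have a0 : (0 <= a)%R by exact: powR_ge0.
  have b0 : (0 <= b)%R by exact: powR_ge0.
  have H : (`|z ord0 i| `^ m <= 2 `^ m * (a + b))%R.
    have -> : z ord0 i = (y ord0 i + (z - y)%R ord0 i)%R by rewrite !mxE; ring.
    exact: powR_normD_le.
  apply: (le_trans (ler_wpM2r _ H)); first by rewrite mulr_ge0.
  rewrite -!mulrA -mulrDr ler_wpM2l ?powR_ge0// mulrDl; apply: lerD.
    by rewrite mulrA (mulrC (a * _)%R) ler_wpM2r ?mulr_ge0.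
  by rewrite mulrCA ler_wpM2r ?mulr_ge0.
rewrite ge0_integralD//; last 4 first.
- by move=> y _; rewrite mule_ge0.
- exact: measurable_funeM.
- by move=> y _; rewrite mule_ge0.
- by apply: measurable_funeM; exact: (mz _ (mcE l.+1)).
rewrite !ge0_integralZl//; last exact: (mz _ (mcE l.+1)).
apply: leeD; rewrite lee_wpmul2l//.
by rewrite (ge0_integral_comp_rsub _ (mcE l.+1)).
Qed.

Variables m B : R.
Hypothesis m2 : (2 <= m)%R.
Hypothesis mom_le : forall i k,
  \int[lebesgue_rV R d]_x (`|x ord0 i| `^ m * p k.+1 x)%:E <=
  (B * k.+1%:R `^ (m / 2))%:E.

(** The [k + 2] steps are cut into two nonempty halves, each of at least a third of the steps.
    Uniform decay of one half against the moment of the other gives the exponent [m / 2 - d / 2];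
    [d^m] is the price of passing to a single coordinate. *)
Lemma walk_density_off_diagonal : exists2 C : R, (0 < C)%R & forall k (z : 'rV[R]_d),
  (enorm z `^ m * p k.+2 z <= C * k.+2%:R `^ ((m - d%:R) / 2))%R.
Proof.
have [A A0 pA] := walk_density_decay d0 mrho rho0 rho1 rhoN rhoM.
have s0 : (0 <= d%:R / 2 :> R)%R by rewrite divr_ge0.
have m0 : (0 <= m / 2)%R by rewrite divr_ge0// (le_trans _ m2).
have B0 : (0 <= B)%R.
  have := mom_le (Ordinal d0) 0; rewrite powR1 mulr1; apply: contraTT.
  rewrite -!ltNge => Bn; apply: lt_le_trans (_ : 0 <= _).
    by rewrite lte_fin.
  by apply: integral_ge0 => x _; rewrite lee_fin mulr_ge0 ?powR_ge0.
pose C := (d%:R `^ m * (2 `^ m * (2 * (A * 3 `^ (d%:R / 2)) * B)))%R.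
have C0 : (0 <= C)%R by rewrite !mulr_ge0 ?powR_ge0// ltW.
exists (C + 1)%R; first by rewrite ltr_wpDl.
move=> k z; pose j := k./2; pose l := (k - k./2)%N.
have jl : (k.+2 = j.+1 + l.+1)%N by rewrite /j /l; lia.
have S3 n y : (k.+2 <= 3 * n.+1)%N ->
    (p n.+1 y <= A * 3 `^ (d%:R / 2) * k.+2%:R `^ (- (d%:R / 2)))%R.
  move=> kn; apply: (le_trans (pA n y)); rewrite -mulrA ler_wpM2l ?(ltW A0)//.
  have -> : (3 `^ (d%:R / 2) = 3^-1 `^ (- (d%:R / 2)) :> R)%R.
    by rewrite -[(3^-1)%R]powR_inv1// -powRrM mulN1r opprK.
  rewrite -powRM// powRN_le// ?mulr_gt0 ?ltr0n//.
  by rewrite mulrC ler_pdivrMr// mulrC -natrM ler_nat.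
have Qn n i : (n.+1 <= k.+2)%N ->
    \int[lebesgue_rV R d]_x (`|x ord0 i| `^ m * p n.+1 x)%:E <=
    (B * k.+2%:R `^ (m / 2))%:E.
  move=> nk; apply: (le_trans (mom_le i n)); rewrite lee_fin ler_wpM2l//.
  by rewrite ge0_ler_powR ?nnegrE ?ler_nat.
have [i zi] := enorm_le_coord z d0.
have H : (`|z ord0 i| `^ m * p (j.+1 + l.+1) z <= 2 `^ m *
    (2 * (A * 3 `^ (d%:R / 2) * k.+2%:R `^ (- (d%:R / 2))) * (B * k.+2%:R `^ (m / 2))))%R.
  apply: walk_density_coord_le.
  - by rewrite (le_trans _ m2).
  - by move=> y; apply: S3; rewrite /j; lia.
  - by move=> y; apply: S3; rewrite /l; lia.
  - by apply: Qn; rewrite /j; lia.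
  - by apply: Qn; rewrite /l; lia.
rewrite -jl in H.
have zm : (enorm z `^ m <= d%:R `^ m * `|z ord0 i| `^ m)%R.
  rewrite -powRM//; apply: ge0_ler_powR; rewrite ?nnegrE ?mulr_ge0 ?enorm_ge0//.
  by rewrite (le_trans _ m2).
apply: (le_trans (ler_wpM2r (p0 _ _) zm)).
rewrite -mulrA; apply: (le_trans (ler_wpM2l (powR_ge0 _ _) H)).
rewrite [leRHS]mulrDl; apply: ler_wpDr; first by rewrite mulr_ge0// powR_ge0.
have -> : ((m - d%:R) / 2 = m / 2 + - (d%:R / 2) :> R)%R by rewrite mulrBl.
rewrite powRD ?pnatr_eq0 ?implybT// /C le_eqVlt; apply/orP; left; apply/eqP; ring.
Qed.

End off_diagonal.

(** * Green function bounds *)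

Section killed_walk.
Context {R : realType} {d : nat}.
Local Open Scope ereal_scope.

Variable rho : 'rV[R]_d -> R.
Hypothesis d0 : (0 < d)%N.
Hypothesis mrho : measurable_fun setT rho.
Hypothesis rho0 : forall x, (0 <= rho x)%R.
Hypothesis rho1 : \int[lebesgue_rV R d]_x (rho x)%:E = 1.
Hypothesis rhoN : forall x, rho x = rho (- x).
Variable M : R.
Hypothesis rhoM : forall x, (rho x <= M)%R.

Local Notation p := (walk_density rho).
Local Notation kd D := (killed_density rho D).
Implicit Types (D : set 'rV[R]_d) (x y z : 'rV[R]_d).

Lemma killed_density_outside D k x y : ~ D y -> kd D k x y = 0.
Proof.
move=> Dy; have st u : killed_step rho D u y = 0.
  by rewrite /killed_step (_ : \1_D y = 0%R) ?mulr0// indicE memNset.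
case: k => [|[|k]]; [exact: st|exact: st|].
by rewrite killed_densityS; under eq_integral do rewrite st mule0; rewrite integral0.
Qed.

Lemma killed_density_mass_le D k x (S : R) : measurable D ->
  (forall y, (kd D k x y <= S%:E)) ->
  \int[lebesgue_rV R d]_y kd D k x y <= S%:E * lebesgue_rV R d D.
Proof.
move=> mD kS; rewrite (_ : \int[_]_y _ = \int[lebesgue_rV R d]_(y in D) kd D k x y).
  rewrite -integral_cst//; apply: ge0_le_integral => //.
  - by move=> y _; exact: killed_density_ge0.
  - by apply: measurable_funTS; exact: measurable_killed_densityr.
rewrite [RHS]integral_mkcond; apply: eq_integral => y _; rewrite patchE.
by case: ifPn => // /negP yD; rewrite killed_density_outside// => Dy; apply: yD; rewrite inE.
Qed.

(** At such times the density is at most [A (L a)^(-d)] while the ball has volume at most [(2 a)^d].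
    With [L = 4 A'] the product is [A (2 A')^(-d)], below one half as [A < A'] and [2 A' > 1]. *)
Lemma survival_le_half : exists2 L : R, (0 < L)%R &
  forall (a : R) (T : nat) x, (0 < a)%R -> ((L * a) ^+ 2 <= T.+1%:R)%R ->
  \int[lebesgue_rV R d]_y kd (eball a) T.+1 x y <= (2^-1)%:E.
Proof.
have [A A0 pA] := walk_density_decay d0 mrho rho0 rho1 rhoN rhoM.
pose A' := (A + 1)%R; have A'0 : (0 < A')%R by rewrite addr_gt0.
exists (4 * A')%R; first by rewrite mulr_gt0.
move=> a T x a0 aT; have L0 : (0 < 4 * A' * a)%R by rewrite !mulr_gt0.
have mB := @measurable_eball R d a.
apply: (le_trans (killed_density_mass_le (S := (A * (4 * A' * a) ^- d)%R) mB _)).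
  move=> y; apply: (le_trans (killed_density_le_walk mrho rho0 rho1 rhoM _ _ _ mB)).
  rewrite lee_fin; apply: (le_trans (pA _ _)); rewrite ler_wpM2l ?(ltW A0)//.
  rewrite -powR_half_exprn ?(ltW L0)//; apply: powRN_le => //.
  by rewrite exprn_gt0.
apply: (le_trans (lee_wpmul2l _ (lebesgue_eball_le (d := d) (ltW a0)))).
  by rewrite lee_fin mulr_ge0 ?invr_ge0 ?exprn_ge0 ?ltW.
rewrite -EFinM lee_fin -(mulrA A) -exprVn -exprMn.
have -> : ((4 * A' * a)^-1 * (2 * a) = (2 * A')^-1)%R.
  by field; rewrite !gt_eqF.
rewrite exprVn ler_pdivrMr ?exprn_gt0 ?mulr_gt0//.
apply: (@le_trans _ _ (2^-1 * (2 * A'))%R).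
  by rewrite mulKf// /A' lerDl.
rewrite ler_wpM2l ?invr_ge0// -{1}[(2 * A')%R]expr1.
by rewrite ler_eXn2l// /A'; lra.
Qed.

(** By the Markov property the terms past one period are an average, of mass at most one half, of
    sums of the same kind, so a bound [G] satisfies [G <= beta + G / 2]. Strong induction on the
    truncation [N] avoids presupposing that the series converges. *)
Lemma killed_green_halving D (T k0 : nat) (beta : R) : measurable D -> (0 < k0)%N ->
  (forall x, \int[lebesgue_rV R d]_y kd D T.+1 x y <= (2^-1)%:E) ->
  (forall x z, \sum_(k0 <= k < k0 + T.+1) kd D k x z <= beta%:E) ->
  forall N x z, \sum_(k0 <= k < N) kd D k x z <= (2 * beta)%:E.
Proof.
move=> mD k00 half sb.
have beta0 : (0 <= beta)%R.
  by rewrite -lee_fin (le_trans _ (sb 0%R 0%R))// sume_ge0// => k _; exact: killed_density_ge0.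
have bb : beta%:E <= (2 * beta)%:E by rewrite lee_fin; lra.
have kd0 k x z : 0 <= kd D k x z by exact: killed_density_ge0.
elim/ltn_ind => N IH x z; have [NT|TN] := leqP N (k0 + T.+1).
  by apply: le_trans (le_trans (sb x z) bb); exact: lee_sum_nneg_natr.
rewrite (big_cat_nat (leq_addr T.+1 k0) (ltnW TN))/=.
have -> : (2 * beta)%:E = beta%:E + beta%:E by rewrite -EFinD; congr _%:E; ring.
apply: leeD => //; rewrite big_addn.
have -> : \sum_(k0 <= k < N - T.+1) kd D (k + T.+1) x z = \int[lebesgue_rV R d]_y
    (kd D T.+1 x y * \sum_(k0 <= k < N - T.+1) kd D k y z).
  transitivity (\int[lebesgue_rV R d]_y
      (\sum_(k0 <= k < N - T.+1) (kd D T.+1 x y * kd D k y z))); last first.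
    by apply: eq_integral => y _; rewrite ge0_sume_distrr.
  rewrite ge0_integral_sum//; last 2 first.
  - move=> k; apply: emeasurable_funM; first exact: measurable_killed_densityr.
    exact: measurable_killed_densityl.
  - by move=> k y _; rewrite mule_ge0.
  rewrite big_nat_cond [RHS]big_nat_cond; apply: eq_bigr => -[|k] /andP[/andP[kk0 _] _].
    by rewrite leqNgt k00 in kk0.
  by rewrite addnC killed_density_add.
apply: (@le_trans _ _ (\int[lebesgue_rV R d]_y (kd D T.+1 x y * (2 * beta)%:E))).
  apply: ge0_le_integral => //.
  - by move=> y _; rewrite mule_ge0// sume_ge0.
  - apply: emeasurable_funM; first exact: measurable_killed_densityr.
    by apply: emeasurable_sum => k; exact: measurable_killed_densityl.
  - by apply: emeasurable_funM => //; exact: measurable_killed_densityr.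
  - move=> y _; rewrite lee_wpmul2l//; apply: IH.
    by rewrite ltn_subrL/= (leq_trans _ TN).
rewrite ge0_integralZr//; last 2 first.
- exact: measurable_killed_densityr.
- by rewrite lee_fin mulr_ge0.
apply: (le_trans (lee_wpmul2r _ (half x))); first by rewrite lee_fin mulr_ge0.
by rewrite -EFinM lee_fin mulrA mulVf// mul1r.
Qed.

End killed_walk.

(** * Sums below and above the diffusive time *)

Section radius_cutoff.
Context {R : realType}.
Implicit Types (t m theta s A C : R).

(* The number of steps after which a walk typically reaches distance [t]. *)
Definition cutoff t : nat := maxn 1 (Num.truncn (t ^+ 2)).

Lemma cutoff_gt0 t : (0 < cutoff t)%N.
Proof. by rewrite leq_max. Qed.

Lemma cutoff_le t : (1 < cutoff t)%N -> (cutoff t)%:R <= t ^+ 2.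
Proof.
have /andP[tt _] := truncn_itv (sqr_ge0 t).
by rewrite /cutoff leq_max ltnn/= => /ltnW/maxn_idPr ->.
Qed.

Lemma cutoff_ge t : t ^+ 2 / 2 <= (cutoff t)%:R.
Proof.
have /andP[_ /ltW tt] := truncn_itv (sqr_ge0 t).
rewrite ler_pdivrMr// (le_trans tt)// -natrM ler_nat.
by rewrite /cutoff; move: (Num.truncn _) => n; lia.
Qed.

Lemma powR_sqr t (s : R) : 0 <= t -> (t ^+ 2) `^ s = t `^ (2 * s).
Proof. by move=> t0; rewrite powRrM powR_mulrn. Qed.

(** As [theta > 0], the sum of [k^(theta - 1)] up to [t^2] is of order [t^(2 theta)], and
    [2 theta - m = 2 - d]. If the cutoff is 1 the sum is empty. *)
Lemma near_sum_le d m theta C t (q : R^nat) : 0 < t -> 0 < theta ->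
  m = 2 * theta + (d%:R - 2) -> 0 <= C ->
  (forall k, t `^ m * q k.+2 <= C * k.+2%:R `^ (theta - 1)) ->
  \sum_(2 <= k < (cutoff t).+1) q k <=
  C * ((1 + theta) / theta) * t `^ (2 - d%:R).
Proof.
move=> t0 th0 mE C0 qle.
have cth0 : 0 <= C * ((1 + theta) / theta).
  by rewrite mulr_ge0// divr_ge0 ?(ltW th0)//; lra.
have [n1|/cutoff_le nt] := leqP (cutoff t) 1.
  by rewrite big_geq ?ltnS// mulr_ge0 ?powR_ge0.
apply: (@le_trans _ _
    (\sum_(2 <= k < (cutoff t).+1) C * t `^ (- m) * k%:R `^ (theta - 1))).
  rewrite big_nat_cond [leRHS]big_nat_cond.
  apply: ler_sum => -[|[|k]] /andP[/andP[// _ _] _].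
  rewrite mulrAC powRN ler_pdivlMr ?powR_gt0// mulrC.
  exact: qle.
rewrite -mulr_sumr.
apply: (@le_trans _ _ (C * t `^ (- m) * ((1 + theta) / theta * (t ^+ 2) `^ theta))).
  rewrite ler_wpM2l ?mulr_ge0 ?powR_ge0//.
  apply: (@le_trans _ _ (\sum_(1 <= k < (cutoff t).+1) k%:R `^ (theta - 1))).
    by rewrite [leRHS]big_ltn ?ltnS ?cutoff_gt0// lerDr powR_ge0.
  apply: (le_trans (sum_powR_near _ th0)); rewrite ler_wpM2l//.
    by rewrite divr_ge0 ?(ltW th0)//; lra.
  by rewrite ge0_ler_powR ?nnegrE ?(ltW th0) ?sqr_ge0.
rewrite powR_sqr ?(ltW t0)// le_eqVlt; apply/orP; left; apply/eqP.
have -> : 2 - d%:R = - m + 2 * theta by rewrite mE; ring.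
by rewrite powRD ?(gt_eqF t0) ?implybT//; ring.
Qed.

(** The tail from [t^2 / 2] on is of order [(t^2 / 2)^(-s) = 2^s t^(2 - d)]. *)
Lemma far_sum_le d s A t N (q : R^nat) : 0 < t -> 0 < s ->
  d%:R = 2 * s + 2 -> 0 <= A ->
  (forall k, q k.+1 <= A * k.+1%:R `^ (- (d%:R / 2))) ->
  \sum_((cutoff t).+1 <= k < N) q k <= A * s^-1 * 2 `^ s * t `^ (2 - d%:R).
Proof.
move=> t0 s0 dE A0 qle.
apply: (@le_trans _ _
    (\sum_((cutoff t).+1 <= k < N) A * k%:R `^ (- s - 1))).
  rewrite big_nat_cond [leRHS]big_nat_cond.
  apply: ler_sum => -[|k] /andP[/andP[// _ _] _].
  have -> : - s - 1 = - (d%:R / 2) by rewrite dE; field.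
  exact: qle.
rewrite -mulr_sumr -!mulrA ler_wpM2l//.
apply: (le_trans (sum_powR_tail _ s0 (cutoff_gt0 t))).
rewrite ler_wpM2l ?invr_ge0 ?(ltW s0)//.
have tt0 : 0 < t ^+ 2 / 2 by rewrite divr_gt0 ?exprn_gt0.
apply: (le_trans (powRN_le (ltW s0) tt0 (cutoff_ge t))).
rewrite powRM ?sqr_ge0 ?invr_ge0// powR_sqr ?(ltW t0)//.
have -> : 2^-1 `^ (- s) = 2 `^ s :> R by rewrite -[2^-1]powR_inv1// -powRrM mulN1r opprK.
have -> : 2 * - s = 2 - d%:R by rewrite dE; ring.
by rewrite mulrC.
Qed.

End radius_cutoff.

(** * Green function bounds at unit scale, by dimension *)

Section green_unit_scale.
Context {R : realType} {d : nat}.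
Local Open Scope ereal_scope.

Variable rho : 'rV[R]_d -> R.
Hypothesis d0 : (0 < d)%N.
Hypothesis mrho : measurable_fun setT rho.
Hypothesis rho0 : forall x, (0 <= rho x)%R.
Hypothesis rho1 : \int[lebesgue_rV R d]_x (rho x)%:E = 1.
Hypothesis rhoN : forall x, rho x = rho (- x).
Variable M : R.
Hypothesis rhoM : forall x, (rho x <= M)%R.

Local Notation p := (walk_density rho).
Local Notation kd a := (killed_density rho (eball a)).

Let kd_le (a : R) k x y : kd a k x y <= (p k (y - x))%:E.
Proof. exact: killed_density_le_walk (measurable_eball _). Qed.

(** Linearity in [a] is needed for small radii too, where summing [k^(-1/2)] over one period would
    only give a constant. There a single step already exits with probability at least one half, and
    the two-step density is at most [M] times the mass [2 M a] left after one step. *)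
Lemma green_unit_dim1 : d = 1%N -> exists2 C : R, (0 < C)%R &
  forall (a : R) z N, (0 < a)%R ->
    \sum_(2 <= k < N) kd a k 0%R z <= (C * a)%:E.
Proof.
move=> d1.
have [A A0 pA] := walk_density_decay d0 mrho rho0 rho1 rhoN rhoM.
have [L L0 surv] := survival_le_half d0 mrho rho0 rho1 rhoN rhoM.
have M0 : (0 <= M)%R by exact: le_trans (rho0 0%R) (rhoM 0%R).
pose M' := (M + 1)%R; have M'0 : (0 < M')%R by rewrite ltr_wpDl.
pose Q := (L + 4 * M')%R; have Q0 : (0 < Q)%R by rewrite addr_gt0// mulr_gt0.
pose C := (2 * (A * 3 * (2 * Q)) + 4 * M ^+ 2)%R.
have C0 : (0 < C)%R by rewrite ltr_pwDl ?mulr_gt0// mulr_ge0// sqr_ge0.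
exists C => // a z N a0; have mB := @measurable_eball R d a.
have kM k x y : kd a k x y <= M%:E by apply: killed_density_le.
have [small|large] := leP (4 * M' * a)%R 1%R.
  have Ma : (M * (2 * a) <= 2^-1)%R.
    move: small; rewrite /M' => small; have : (0 <= M * a)%R by rewrite mulr_ge0 ?(ltW a0).
    by nra.
  have mass x : \int[lebesgue_rV R d]_y kd a 1 x y <= (M * (2 * a))%:E.
    apply: (le_trans (killed_density_mass_le mrho rho0 mB (fun y => kM 1%N x y))).
    rewrite EFinM lee_wpmul2l ?lee_fin// -[X in _ <= X%:E]expr1.
    by rewrite -[X in (_ ^+ X)%R]d1 lebesgue_eball_le ?ltW.
  apply: (le_trans (killed_green_halving (T := 0) (beta := (M * (2 * a) * M)%R)
      mrho rho0 mB _ _ _ N 0%R z)) => //.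
  - by move=> x; rewrite (le_trans (mass x)).
  - move=> x y; rewrite big_nat1 killed_densityS.
    apply: (@le_trans _ _ (\int[lebesgue_rV R d]_u (kd a 1 x u * M%:E))).
      apply: ge0_le_integral => //.
      + by move=> u _; rewrite mule_ge0 ?killed_density_ge0 ?killed_step_ge0.
      + apply: emeasurable_funM; first exact: measurable_killed_densityr.
        exact: (measurable_killed_densityl mrho rho0 mB 1%N y).
      + apply: emeasurable_funM => //; exact: measurable_killed_densityr.
      + by move=> u _; rewrite lee_wpmul2l ?killed_density_ge0//; exact: (kM 1%N).
    rewrite ge0_integralZr//.
    + by rewrite EFinM lee_wpmul2r// lee_fin.
    + exact: measurable_killed_densityr.
    + by move=> u _; exact: killed_density_ge0.
  rewrite lee_fin /C [leRHS]mulrDl; apply: ler_wpDl.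
    by rewrite mulr_ge0 ?(ltW a0)// mulr_ge0// ltW // mulr_gt0// mulr_gt0.
  by rewrite le_eqVlt; apply/orP; left; apply/eqP; ring.
pose T := Num.truncn ((L * a) ^+ 2)%R.
have /andP[T1 /ltW T2] := truncn_itv (sqr_ge0 (L * a)%R).
(* [Q] was chosen for this: in the large regime [4 M' a > 1], so the additive 2 is absorbed into the
   square. *)
have TQ : (T.+2%:R <= (2 * Q * a) ^+ 2)%R.
  have La0 : (0 < L * a)%R by rewrite mulr_gt0.
  apply: (@le_trans _ _ ((L * a) ^+ 2 + 2)%R).
    by rewrite -addn2 natrD lerD2r.
  by rewrite /Q; move: large La0; move: (4 * M')%R => w; nra.
have kA k x y : kd a k.+1 x y <= (A * k.+1%:R `^ (- (2^-1)))%:E.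
  apply: (le_trans (kd_le _ _ _ _)); rewrite lee_fin.
  have hd : (d%:R / 2 = 2^-1 :> R)%R by rewrite d1 mul1r.
  by rewrite -hd.
apply: (le_trans (killed_green_halving (T := T) (beta := (A * 3 * (2 * Q * a))%R)
      mrho rho0 mB _ _ _ N 0%R z)) => //.
- by move=> x; exact: surv.
- move=> x y; apply: (@le_trans _ _
    (\sum_(2 <= k < 2 + T.+1) (A * k%:R `^ (2^-1 - 1))%:E)).
    rewrite big_nat_cond [leRHS]big_nat_cond.
    apply: lee_sum => -[|k] /andP[/andP[// _ _] _].
    have -> : (2^-1 - 1 = - 2^-1 :> R)%R by field.
    exact: kA.
  rewrite sumEFin lee_fin -mulr_sumr -mulrA ler_wpM2l ?(ltW A0)//.
  apply: (@le_trans _ _ (\sum_(1 <= k < T.+2.+1) k%:R `^ (2^-1 - 1))%R).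
    by rewrite add2n [leRHS]big_ltn// lerDr powR_ge0.
  have h0 : (0 < 2^-1 :> R)%R by rewrite invr_gt0.
  apply: (le_trans (sum_powR_near _ h0)).
  have -> : ((1 + 2^-1) / 2^-1 = 3 :> R)%R by field.
  rewrite ler_wpM2l// powR12_sqrt// -[leRHS]ger0_norm ?mulr_ge0 ?(ltW Q0) ?(ltW a0)//.
  by rewrite -sqrtr_sqr ler_sqrt ?sqr_ge0.
rewrite lee_fin /C [leRHS]mulrDl; apply: ler_wpDr.
  by rewrite mulr_ge0 ?(ltW a0)// mulr_ge0 ?sqr_ge0.
by rewrite le_eqVlt; apply/orP; left; apply/eqP; ring.
Qed.

End green_unit_scale.

Section green_unit_scale_dim_ge2.
Context {R : realType} {d : nat}.

Variable rho : 'rV[R]_d -> R.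
Hypothesis d1 : (1 < d)%N.
Hypothesis mrho : measurable_fun setT rho.
Hypothesis rho0 : forall x, 0 <= rho x.
Hypothesis rho1 : (\int[lebesgue_rV R d]_x (rho x)%:E = 1)%E.
Hypothesis rhoN : forall x, rho x = rho (- x).
Variable M : R.
Hypothesis rhoM : forall x, rho x <= M.

Variables m B : R.
Hypothesis m2 : 2 <= m.
Hypothesis dm : d%:R - 2 < m.
Hypothesis mom_le : forall i k,
  (\int[lebesgue_rV R d]_x (`|x ord0 i| `^ m * walk_density rho k.+1 x)%:E <=
   (B * k.+1%:R `^ (m / 2))%:E)%E.

Local Notation p := (walk_density rho).
Local Notation kd a := (killed_density rho (eball a)).

Let d0 : (0 < d)%N. Proof. exact: ltnW. Qed.

(** [theta] is positive precisely because [m > d - 2]. *)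
Lemma green_near_le : exists2 C : R, 0 < C & forall z : 'rV[R]_d, z != 0 ->
  \sum_(2 <= k < (cutoff (enorm z)).+1) p k z <= C * enorm z `^ (2 - d%:R).
Proof.
have [C C0 offd] :=
  walk_density_off_diagonal d0 mrho rho0 rho1 rhoN rhoM m2 mom_le.
pose theta := (m - d%:R) / 2 + 1; have th0 : 0 < theta by have := dm; rewrite /theta; lra.
exists (C * ((1 + theta) / theta)).
  by rewrite mulr_gt0// divr_gt0// addr_gt0.
move=> z z0; apply: (near_sum_le (m := m)) => //.
- by rewrite lt_neqAle enorm_ge0 eq_sym enorm_eq0 z0.
- by rewrite /theta; field.
- exact: ltW.
- by move=> k; rewrite /theta addrK; exact: offd.
Qed.

(** Killing is dropped altogether: for [d >= 3] the uniform decay is summable and the free walk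
    already obeys the bound. *)
Lemma green_unit_dim_ge3 : (2 < d)%N -> exists2 C : R, 0 < C &
  forall (z : 'rV[R]_d) N, z != 0 ->
    \sum_(2 <= k < N) p k z <= C * enorm z `^ (2 - d%:R).
Proof.
move=> d2; have [C C0 near] := green_near_le.
have [A A0 pA] := walk_density_decay d0 mrho rho0 rho1 rhoN rhoM.
pose s : R := d%:R / 2 - 1; have s0 : 0 < s.
  by rewrite /s; move: d2; rewrite -(ltr_nat R) => d2; lra.
have p0 k z : 0 <= p k z by exact: walk_density_ge0.
have far0 : 0 <= A * s^-1 * 2 `^ s.
  by rewrite mulr_ge0 ?powR_ge0// mulr_ge0 ?invr_ge0 ?ltW.
exists (C + A * s^-1 * 2 `^ s); first by rewrite ltr_pwDl.
move=> z N z0; have t0 : 0 < enorm z by rewrite lt_neqAle enorm_ge0 eq_sym enorm_eq0 z0.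
set n := cutoff (enorm z); have n2 : (2 <= n.+1)%N by rewrite ltnS cutoff_gt0.
(* Enlarging the range makes it reach the cutoff, so that it can be split there whatever [N] is. *)
apply: (@le_trans _ _ (\sum_(2 <= k < maxn N n.+1) p k z)).
  have [N2|N2] := leqP N 2; first by rewrite big_geq// sumr_ge0.
  by rewrite [leRHS](big_cat_nat (ltnW N2) (leq_maxl _ _))/= lerDl sumr_ge0.
rewrite (big_cat_nat n2 (leq_maxr _ _))/= mulrDl; apply: lerD; first exact: near.
apply: far_sum_le => //; [by rewrite /s; field|exact: ltW].
Qed.

(** Three ranges of [k]: up to [|z|^2] the off-diagonal decay contributes a constant; from there to
    [T], about [(L a)^2], the terms [A / k] give the logarithm; beyond [T] killing leaves at most
    [2 A]. *)
Lemma green_unit_dim2 : d = 2%N -> exists2 C : R, 0 < C &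
  forall (a : R) (z : 'rV[R]_d) N, z != 0 -> enorm z < a ->
    (\sum_(2 <= k < N) kd a k 0 z <= (C * (ln (a / enorm z) + 1))%:E)%E.
Proof.
move=> d2; have [C C0 near] := green_near_le.
have [A A0 pA] := walk_density_decay d0 mrho rho0 rho1 rhoN rhoM.
have [L L0 surv] := survival_le_half d0 mrho rho0 rho1 rhoN rhoM.
have p0 k z : 0 <= p k z by exact: walk_density_ge0.
have hd : d%:R / 2 = 1 :> R by rewrite d2 divff.
have pA1 k z : p k.+1 z <= A * k.+1%:R^-1.
  by have := pA k z; rewrite hd powR_inv1.
pose L2 := 2 * L ^+ 2 + 1; have L20 : 1 <= L2.
  by rewrite /L2 lerDr mulr_ge0// sqr_ge0.
have lnL2 : 0 <= ln L2 by exact: ln_ge0.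
pose C' := C + A * (ln L2 + 2) + 2 * A.
have C'0 : 0 < C'.
  rewrite /C' -addrA ltr_pwDl// addr_ge0// mulr_ge0 ?(ltW A0)//.
  by rewrite addr_ge0.
exists C' => // a z N z0 za; set t := enorm z.
have t0 : 0 < t by rewrite lt_neqAle enorm_ge0 eq_sym enorm_eq0 z0.
have a0 : 0 < a by exact: lt_trans za.
have at1 : 1 <= a / t by rewrite ler_pdivlMr// mul1r ltW.
have lnat : 0 <= ln (a / t) by exact: ln_ge0.
have mB := @measurable_eball R d a.
have kd0 k x y : (0 <= kd a k x y)%E by exact: killed_density_ge0.
have kdp k x y : (kd a k x y <= (p k (y - x))%:E)%E.
  exact: killed_density_le_walk mB.
pose T := Num.truncn ((L * a) ^+ 2).
have /andP[T1 /ltW T2] := truncn_itv (sqr_ge0 (L * a)).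
have tail N' : (\sum_(T.+2 <= k < N') kd a k 0 z <= (2 * A)%:E)%E.
  apply: (killed_green_halving (T := T) mrho rho0 mB) => //.
    by move=> x; exact: surv.
  (* A period started at [T + 2] has [T + 1] terms, each at most [A / (T + 2)]. *)
  move=> x y; apply: (@le_trans _ _
      (\sum_(T.+2 <= k < T.+2 + T.+1) (A * T.+2%:R^-1)%:E)%E).
    rewrite big_nat_cond [leRHS]big_nat_cond.
    apply: lee_sum => -[|k] /andP[/andP[// Tk _] _].
    apply: (le_trans (kdp _ _ _)); rewrite lee_fin; apply: (le_trans (pA1 _ _)).
    by rewrite ler_wpM2l ?(ltW A0)// lef_pV2 ?posrE ?ltr0n// ler_nat.
  rewrite sumEFin lee_fin sumr_const_nat addKn -[leLHS]mulr_natl mulrCA.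
  by rewrite -[leRHS]mulr1 ler_wpM2l ?(ltW A0)// ler_pdivrMr ?ltr0n// mul1r ler_nat.
set n := cutoff t; have n2 : (2 <= n.+1)%N by rewrite ltnS cutoff_gt0.
have n0 : 0 < n%:R :> R by rewrite ltr0n cutoff_gt0.
have nearz : \sum_(2 <= k < n.+1) p k z <= C.
  have := near z z0; rewrite -/t -/n.
  have -> : 2 - d%:R = 0 :> R by rewrite d2 subrr.
  by rewrite powRr0 mulr1.
have head : \sum_(2 <= k < T.+2) p k z <= C + A * (ln L2 + 2 * ln (a / t)).
  have E0 : 0 <= A * (ln L2 + 2 * ln (a / t)).
    by rewrite mulr_ge0 ?(ltW A0)// addr_ge0// mulr_ge0.
  (* If [T] does not exceed the cutoff, the middle range is empty and the near part suffices. *)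
  have [Tn|nT] := leqP T.+2 n.+1.
    apply: ler_wpDr => //; apply: le_trans nearz.
    by rewrite [leRHS](big_cat_nat (_ : 2 <= T.+2)%N Tn)//= lerDl sumr_ge0.
  rewrite (big_cat_nat n2 (ltnW nT))/=; apply: lerD => //.
  apply: (@le_trans _ _ (\sum_(n.+1 <= k < T.+2) A * k%:R^-1)).
    rewrite big_nat_cond [leRHS]big_nat_cond.
    by apply: ler_sum => -[|k] /andP[/andP[// _ _] _]; exact: pA1.
  rewrite -mulr_sumr ler_wpM2l ?(ltW A0)//.
  apply: (le_trans (sum_inv_log (N := T.+1) (cutoff_gt0 t) _)); first by rewrite -ltnS ltnW.
  have TL : T.+1%:R / n%:R <= L2 * (a / t) ^+ 2.
    have nt : t ^+ 2 / 2 <= n%:R by exact: cutoff_ge.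
    have n1 : 1 <= n%:R :> R by rewrite ler1n cutoff_gt0.
    have T3 : T.+1%:R <= (L * a) ^+ 2 + 1 by rewrite -natr1 lerD2r.
    rewrite ler_pdivrMr//; apply: (le_trans T3).
    have q1 : 1 <= (a / t) ^+ 2 by rewrite exprn_ege1.
    have -> : (L * a) ^+ 2 = 2 * L ^+ 2 * ((a / t) ^+ 2 * (t ^+ 2 / 2)).
      by field; rewrite gt_eqF.
    have h1 : 2 * L ^+ 2 * ((a / t) ^+ 2 * (t ^+ 2 / 2)) <=
        2 * L ^+ 2 * ((a / t) ^+ 2 * n%:R).
      apply: ler_wpM2l; first by rewrite mulr_ge0 ?sqr_ge0.
      by apply: ler_wpM2l => //; exact: sqr_ge0.
    have h2 : 1 <= (a / t) ^+ 2 * n%:R by rewrite -[leLHS]mulr1 ler_pM.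
    have -> : L2 * (a / t) ^+ 2 * n%:R =
        2 * L ^+ 2 * ((a / t) ^+ 2 * n%:R) + (a / t) ^+ 2 * n%:R.
      by rewrite /L2; ring.
    exact: lerD.
  have L2p : 0 < L2 by exact: lt_le_trans L20.
  have atp : 0 < a / t by exact: lt_le_trans at1.
  have -> : ln L2 + 2 * ln (a / t) = ln (L2 * (a / t) ^+ 2).
    by rewrite [RHS]lnM ?posrE ?exprn_gt0// lnXn// mulr_natl.
  by rewrite ler_ln ?posrE ?mulr_gt0 ?exprn_gt0 ?invr_gt0 ?ltr0n ?cutoff_gt0.
apply: (@le_trans _ _ (\sum_(2 <= k < maxn N T.+2) kd a k 0 z)%E).
  by apply: lee_sum_nneg_natr => //; exact: leq_maxl.
rewrite (big_cat_nat (_ : 2 <= T.+2)%N (leq_maxr _ _))//=.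
apply: (@le_trans _ _ ((C + A * (ln L2 + 2 * ln (a / t)))%:E + (2 * A)%:E)%E).
  apply: leeD; last exact: tail.
  apply: (@le_trans _ _ (\sum_(2 <= k < T.+2) (p k z)%:E)%E).
    by apply: lee_sum => k _; have := kdp k 0 z; rewrite subr0.
  by rewrite sumEFin lee_fin.
rewrite -EFinD lee_fin -subr_ge0 /C'.
have -> : (C + A * (ln L2 + 2) + 2 * A) * (ln (a / t) + 1) -
    (C + A * (ln L2 + 2 * ln (a / t)) + 2 * A) =
    (C + 2 * A) * ln (a / t) + A * ln L2 * ln (a / t) + 2 * A by ring.
by rewrite !addr_ge0 ?mulr_ge0 ?addr_ge0 ?mulr_ge0 ?(ltW A0) ?(ltW C0).
Qed.

End green_unit_scale_dim_ge2.

(** * Reduction of a general step scale to scale 1 *)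

Section scaling.
Context {R : realType} {d : nat}.
Local Open Scope ereal_scope.

Variable rho : 'rV[R]_d -> R.
Hypothesis mrho : measurable_fun setT rho.
Hypothesis rho0 : forall x, (0 <= rho x)%R.

(** Composition multiplies the two prefactors [r ^- d], and the change of variables returns one
    factor [r ^+ d], so the same prefactor holds for every number of steps. *)
Lemma killed_density_scale (r a : R) k x y : (0 < r)%R ->
  killed_density (scaled_density rho r) (eball a) k x y =
  (r ^- d)%:E * killed_density rho (eball (a / r)) k (r^-1 *: x)%R (r^-1 *: y)%R.
Proof.
move=> r0; have ir0 : (0 < r^-1)%R by rewrite invr_gt0.
have mB := @measurable_eball R d (a / r).
have step u w : killed_step (scaled_density rho r) (eball a) u w =
    (r ^- d)%:E * killed_step rho (eball (a / r)) (r^-1 *: u)%R (r^-1 *: w)%R.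
  have ind (v : 'rV[R]_d) : (\1_(eball a) v = \1_(eball (a / r)) (r^-1 *: v) :> R)%R.
    rewrite !indicE; congr (nat_of_bool _)%:R; apply/idP/idP; rewrite !inE /eball/=;
      by rewrite enormZ ?(ltW ir0)// mulrC ltr_pM2r.
  by rewrite /killed_step /scaled_density !ind scalerBr -EFinM !mulrA.
case: k => [|k]; first exact: step.
elim: k x y => [|k IH] x y; first exact: step.
rewrite !killed_densityS.
pose F z := killed_density rho (eball (a / r)) k.+1 (r^-1 *: x)%R z *
  killed_step rho (eball (a / r)) z (r^-1 *: y)%R.
have mF : measurable_fun setT F.
  apply: emeasurable_funM; first exact: measurable_killed_densityr.
  exact: (measurable_killed_densityl mrho rho0 mB 1%N).
have F0 z : 0 <= F z by rewrite mule_ge0 ?killed_density_ge0 ?killed_step_ge0.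
transitivity (\int[lebesgue_rV R d]_z ((r ^- d * r ^- d)%:E * F (r^-1 *: z + 0)%R)).
  by apply: eq_integral => z _; rewrite IH step addr0 EFinM muleACA.
rewrite ge0_integralZl//.
- rewrite ge0_integral_affine ?gt_eqF// gtr0_norm// muleA -EFinM exprVn invrK.
  by rewrite mulfVK ?gt_eqF ?exprn_gt0.
- apply: measurableT_comp => //; apply: measurable_rVD => //.
  exact: measurable_rVZ.
- by rewrite lee_fin mulr_ge0// invr_ge0 exprn_ge0// ltW.
Qed.

(** A bound on all partial sums passes to the series, so the unit-scale estimates need only treat
    finite sums. *)
Lemma killed_green_scale_le (sigma r a b : R) z : (0 < r)%R ->
  (forall N, \sum_(2 <= k < N)
     killed_density rho (eball (a / r)) k 0%R (r^-1 *: z)%R <= b%:E) ->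
  killed_green rho sigma r (eball a) 0%R z <=
  (sigma ^+ 2 * (r ^+ 2 * r ^- d * b))%:E.
Proof.
move=> r0 sb; rewrite /killed_green.
have kd0 k : 0 <= killed_density (scaled_density rho r) (eball a) k 0%R z.
  rewrite killed_density_scale// mule_ge0 ?killed_density_ge0//.
  by rewrite lee_fin invr_ge0 exprn_ge0// ltW.
have -> : (sigma ^+ 2 * (r ^+ 2 * r ^- d * b))%:E =
    (sigma ^+ 2 * r ^+ 2)%:E * (r ^- d * b)%:E.
  by rewrite -EFinM; congr _%:E; ring.
apply: lee_wpmul2l; first by rewrite lee_fin -exprMn sqr_ge0.
apply: lime_le; first by apply: is_cvg_nneseries => k _ _; exact: kd0.
apply: nearW => N; under eq_bigr do rewrite killed_density_scale// scaler0.
rewrite -ge0_sume_distrr; last by move=> k _; exact: killed_density_ge0.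
by rewrite EFinM lee_wpmul2l// lee_fin invr_ge0 exprn_ge0// ltW.
Qed.

Lemma killed_green_outside (sigma r a : R) z : (0 < r)%R -> ~ eball a z ->
  killed_green rho sigma r (eball a) 0%R z <= 0.
Proof.
move=> r0 az; apply: le_trans (killed_green_scale_le (b := 0%R) _ r0 _) _.
  move=> N; rewrite big1// => k _; apply: killed_density_outside.
  rewrite /eball/= enormZ ?invr_ge0 ?(ltW r0)// mulrC ltr_pM2r ?invr_gt0//.
by rewrite !mulr0.
Qed.

End scaling.

(** Each coordinate moment is dominated by the Euclidean one, hence finite. Summing the absolute
    values of the coordinatewise constants makes [B] uniform in [i]. *)
Lemma walk_moments_of_enorm_moment {R : realType} {d : nat} (rho : 'rV[R]_d -> R)
    (sigma M m : R) :
  measurable_fun setT rho -> (forall x, 0 <= rho x) ->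
  (\int[lebesgue_rV R d]_x (rho x)%:E = 1)%E ->
  (forall x, rho x = rho (- x)) -> (forall x, rho x <= M) ->
  (forall i : 'I_d, (\int[lebesgue_rV R d]_x (x ord0 i * x ord0 i * rho x)%:E =
    (sigma ^+ 2)%:E)%E) ->
  2 <= m -> (\int[lebesgue_rV R d]_x (enorm x `^ m * rho x)%:E < +oo)%E ->
  exists B : R, forall i k,
    (\int[lebesgue_rV R d]_x (`|x ord0 i| `^ m * walk_density rho k.+1 x)%:E <=
     (B * k.+1%:R `^ (m / 2))%:E)%E.
Proof.
move=> mrho rho0 rho1 rhoN rhoM rho_var m2 rho_mom.
have m0 : 0 <= m by rewrite (le_trans _ m2).
have menorm : measurable_fun setT (fun x : 'rV[R]_d => enorm x).
  have msum : measurable_fun setT (fun x : 'rV[R]_d => \sum_(i < d) x ord0 i ^+ 2).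
    by apply: measurable_sum => i; apply: measurable_funX; exact: measurable_coord_rV.
  exact: measurableT_comp (continuous_measurable_fun (@sqrt_continuous R)) msum.
have bound i : exists B : R, forall k,
    (\int[lebesgue_rV R d]_x (`|x ord0 i| `^ m * walk_density rho k.+1 x)%:E <=
     (B * k.+1%:R `^ (m / 2))%:E)%E.
  pose I := (\int[lebesgue_rV R d]_x (`|x ord0 i| `^ m * rho x)%:E)%E.
  have I0 : (0 <= I)%E.
    by apply: integral_ge0 => x _; rewrite lee_fin mulr_ge0 ?powR_ge0.
  have Ifin : I \is a fin_num.
    rewrite (ge0_fin_numE I0).
    apply: le_lt_trans rho_mom.
    apply: ge0_le_integral.
    - by [].
    - by move=> x _; rewrite lee_fin mulr_ge0 ?powR_ge0.
    - apply/measurable_EFinP; apply: measurable_funM => //.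
      exact: measurable_coord_powR.
    - apply/measurable_EFinP; apply: measurable_funM => //.
      by apply: (measurableT_comp (f := fun t : R => t `^ m)).
    - move=> x _; rewrite lee_fin ler_wpM2r// ge0_ler_powR ?nnegrE ?enorm_ge0//.
      exact: le_enorm.
  have var : (\int[lebesgue_rV R d]_x (x ord0 i ^+ 2 * rho x)%:E = (sigma ^+ 2)%:E)%E.
    by rewrite -(rho_var i); apply: eq_integral => x _; rewrite expr2.
  have [B _ BP] := walk_moment_le mrho rho0 rho1 rhoN rhoM m2 var
    (esym (fineK Ifin)).
  by exists B.
have [Bf BfP] := choice bound.
exists (\sum_i `|Bf i|) => i k; apply: (le_trans (BfP i k)).
rewrite lee_fin ler_wpM2r ?powR_ge0// (bigD1 i)//=.
by rewrite (le_trans (ler_norm _))// lerDl sumr_ge0.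
Qed.

Unset Implicit Arguments.

Theorem proposition4p1 (R : realType) (d : nat) (d_ge1 : (1 <= d)%N)
    (rho : 'rV[R]_d -> R) (sigma : R)
    (rho_meas : measurable_fun [set: 'rV[R]_d] rho)
    (rho_ge0 : forall x, 0 <= rho x)
    (rho_int1 : (\int[lebesgue_rV R d]_x (rho x)%:E = 1)%E)
    (rho_sym : forall x, rho x = rho (- x))
    (sigma_gt0 : 0 < sigma)
    (rho_cov : forall i j : 'I_d,
      (\int[lebesgue_rV R d]_x (x ord0 i * x ord0 j * rho x)%:E =
       (sigma ^+ 2 * (i == j)%:R)%:E)%E)
    (rho_bounded : exists M : R, forall x, rho x <= M)
    (rho_moment : exists2 delta : R, 0 < delta &
      (\int[lebesgue_rV R d]_x
         (enorm x `^ Num.max 2 (d%:R - 2 + delta) * rho x)%:E < +oo)%E) :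
  exists2 C : R, 0 < C &
    forall r : R^nat,
      (forall n, 0 < r n <= 1) ->
      nonincreasing_seq r ->
      r n @[n --> \oo] --> 0 ->
      forall a : R, 0 < a ->
      forall (z : 'rV[R]_d) (n : nat),
        (killed_green rho sigma (r n) (eball a) 0%R z <= green_bound C a z)%E.
Proof.
have [M rhoM] := rho_bounded; have [delta delta0 rho_mom] := rho_moment.
have s20 : 0 <= sigma ^+ 2 by exact: sqr_ge0.
pose m : R := Num.max 2 (d%:R - 2 + delta).
have m2 : 2 <= m by rewrite le_max lexx.
have dm : d%:R - 2 < m by rewrite lt_max; apply/orP; right; rewrite ltrDl.
have rho_var (i : 'I_d) : (\int[lebesgue_rV R d]_x
    (x ord0 i * x ord0 i * rho x)%:E = (sigma ^+ 2)%:E)%E.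
  by rewrite rho_cov eqxx mulr1.
have [B mom_le] := walk_moments_of_enorm_moment rho_meas rho_ge0 rho_int1 rho_sym
  rhoM rho_var m2 rho_mom.
(* Outside the ball the left side is at most 0 and the bound is 0, so [z] may be taken inside; [C]
   is chosen before [r], [a] and [z]. *)
suff [C C0 CP] : exists2 C : R, 0 < C & forall (r a : R) (z : 'rV[R]_d),
    0 < r -> 0 < a -> enorm z < a ->
    (killed_green rho sigma r (eball a) 0 z <= green_bound C a z)%E.
  exists C => // r r01 _ _ a a0 z n.
  have r0 : 0 < r n by have /andP[] := r01 n.
  have [za|az] := ltP (enorm z) a; first exact: CP.
  have naz : ~ eball a z by rewrite /eball/=; apply/negP; rewrite -leNgt.
  apply: (le_trans (killed_green_outside rho_meas rho_ge0 sigma r0 naz)).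
  by rewrite /green_bound indicE memNset// mule0.
have scaled (r : R) (z : 'rV[R]_d) : 0 < r -> enorm (r^-1 *: z) = enorm z / r.
  by move=> r0; rewrite enormZ ?invr_ge0 ?(ltW r0)// mulrC.
have znz (r : R) (z : 'rV[R]_d) : 0 < r -> z != 0 -> r^-1 *: z != 0.
  by move=> r0 z0; rewrite scaler_eq0 negb_or invr_eq0 gt_eqF.
have ind (a : R) (z : 'rV[R]_d) : enorm z < a -> \1_(eball a) z = 1 :> R.
  by move=> za; rewrite indicE mem_set.
(* [green_bound] is defined by cases on the dimension, so everything depending on [d] is generalised
   before the case analysis. *)
case: d d_ge1 rho rho_meas rho_ge0 rho_int1 rho_sym rho_cov rho_bounded rho_moment
  rhoM rho_mom m m2 dm rho_var mom_le scaled znz ind => [//|[|[|d]]] d_ge1 rho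
  rho_meas rho_ge0 rho_int1 rho_sym _ _ _ rhoM _ m m2 dm _ mom_le scaled znz ind.
(* In each dimension the factor [r ^+ 2 * r ^- d] cancels the powers of [r] in the unit-scale bound
   for radius [a / r], leaving [sigma ^+ 2] times the unit-scale constant. *)
- have [C C0 CP] := green_unit_dim1 d_ge1 rho_meas rho_ge0 rho_int1 rho_sym rhoM erefl.
  exists (sigma ^+ 2 * C); first by rewrite mulr_gt0 ?exprn_gt0.
  move=> r a z r0 a0 za; have ar0 : 0 < a / r by exact: divr_gt0.
  apply: (le_trans (killed_green_scale_le (b := C * (a / r)) rho_meas rho_ge0 sigma r0 _)).
    by move=> N; exact: CP.
  rewrite /green_bound ind// mule1 lee_fin -[leRHS]mulrA ler_wpM2l//.
  by rewrite le_eqVlt; apply/orP; left; apply/eqP; field; rewrite gt_eqF.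
- have [C C0 CP] := green_unit_dim2 (isT : 1 < 2)%N rho_meas rho_ge0 rho_int1 rho_sym rhoM m2
    dm mom_le erefl.
  exists (sigma ^+ 2 * C); first by rewrite mulr_gt0 ?exprn_gt0.
  move=> r a z r0 a0 za; rewrite /green_bound ind// mule1.
  (* The bound is [+oo] at the origin by convention. *)
  have [->|z0] := eqVneq z 0; first by rewrite leey.
  have t0 : 0 < enorm z by rewrite lt_neqAle enorm_ge0 eq_sym enorm_eq0 z0.
  have E : a / r / enorm (r^-1 *: z) = a / enorm z.
    by rewrite scaled//; field; rewrite !gt_eqF.
  apply: (le_trans (killed_green_scale_le (b := C * (ln (a / enorm z) + 1))
    rho_meas rho_ge0 sigma r0 _)).
    move=> N; rewrite -E; apply: CP; first exact: znz.
    by rewrite scaled// ltr_pM2r ?invr_gt0.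
  have l0 : 0 <= ln (a / enorm z) by rewrite ln_ge0// ler_pdivlMr// mul1r ltW.
  rewrite lee_fin (max_idPl l0) -[leRHS]mulrA ler_wpM2l//.
  by rewrite mulfV ?mul1r// gt_eqF// exprn_gt0.
- have [C C0 CP] := green_unit_dim_ge3 (isT : 1 < d.+3)%N rho_meas rho_ge0 rho_int1
    rho_sym rhoM m2 dm mom_le isT.
  exists (sigma ^+ 2 * C); first by rewrite mulr_gt0 ?exprn_gt0.
  move=> r a z r0 a0 za; rewrite /green_bound ind// mule1.
  have [->|z0] := eqVneq z 0; first by rewrite leey.
  have t0 : 0 < enorm z by rewrite lt_neqAle enorm_ge0 eq_sym enorm_eq0 z0.
  have mB := @measurable_eball R d.+3 (a / r).
  apply: (le_trans (killed_green_scale_le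
    (b := C * (enorm z / r) `^ (2 - d.+3%:R)) rho_meas rho_ge0 sigma r0 _)).
    move=> N; rewrite -scaled//.
    apply: (@le_trans _ _ (\sum_(2 <= k < N)
        (walk_density rho k (r^-1 *: z))%:E)%E).
      apply: lee_sum => k _; rewrite -[X in walk_density rho k X]subr0.
      exact: killed_density_le_walk mB.
    by rewrite sumEFin lee_fin; apply: CP; exact: znz.
  rewrite lee_fin -[leRHS]mulrA ler_wpM2l//.
  rewrite powRM ?invr_ge0 ?(ltW t0) ?(ltW r0)//.
  have -> : enorm z ^ (2 - d.+3%:Z) = enorm z `^ (2 - d.+3%:R).
    by rewrite -powR_intmul ?(ltW t0)// intrB.
  have -> : r^-1 `^ (2 - d.+3%:R) = r ^+ d.+3 / r ^+ 2.
    rewrite -powR_inv1 ?(ltW r0)// -powRrM mulN1r opprB powRB ?(gt_eqF r0) ?implybT//.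
    by rewrite !powR_mulrn ?(ltW r0).
  rewrite le_eqVlt; apply/orP; left; apply/eqP; field.
  by rewrite expf_neq0 !gt_eqF.
Qed.
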